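(* Let $n\ge2$ and $A_{n-1}=k[u]/(u^n)$. The Orlov spectrum of $\operatorname{D}_{\operatorname{sg}}(A_{n-1})$ is $$\left\{\left\lceil\frac{\lfloor n/2\rfloor}{s}\right\rceil-1\ :\ s\in\mathbb N,\ s\ge1\right\},$$ where $\lfloor\alpha\rfloor$ is the greatest integer less than or equal to $\alpha$ and $\lceil\alpha\rceil$ is the least integer greater than or equal to $\alpha$.
   Context: $k$ is an algebraically closed field of characteristic zero and all categories are $k$-linear. Generation time: for a full subcategory $\mathcal I$ of a triangulated category $\mathcal T$, $\langle\mathcal I\rangle$ is the smallest full subcategory containing $\mathcal I$ closed under isomorphisms, shifts, finite coproducts and direct summands. $\mathcal I_1*\mathcal I_2$ is the full subcategory of objects $B$ in a distinguished triangle $B_1\to B\to B_2\to B_1[1]$ with $B_i\in\mathcal I_i$; $\mathcal I_1\diamond\mathcal I_2:=\langle\mathcal I_1*\mathcal I_2\rangle$; $\langle\mathcal I\rangle_0:=\langle\mathcal I\rangle$ and $\langle\mathcal I\rangle_n:=\langle\mathcal I\rangle_{n-1}\diamond\langle\mathcal I\rangle$. For an object $G$, the generation time of $G$ is the least $n\ge0$ with $\langle G\rangle_n=\mathcal T$ ($\infty$ if there is none). The Orlov spectrum of $\mathcal T$ is the set of finite generation times of objects of $\mathcal T$. For a commutative Noetherian $k$-algebra $S$, $\operatorname{D}_{\operatorname{sg}}(S)$ is the Verdier quotient of $\operatorname{D}^{\operatorname{b}}(\operatorname{mod} S)$ (finitely generated modules) by the subcategory of bounded complexes of finitely generated projective modules.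 *)

(* Defs.v *)
From HB Require Import structures.
From mathcomp Require Import all_boot all_order all_algebra.
From mathcomp Require Import zify.

Set Implicit Arguments.
Unset Strict Implicit.
Unset Printing Implicit Defensive.

Import Order.TTheory GRing.Theory Num.Theory.
Local Open Scope ring_scope.

(* Morphisms are compared by the equivalence relation [heq], not by Leibniz
   equality, so that hom-sets such as "chain maps modulo homotopy" need no
   quotient types. *)
Record shiftCat := ShiftCat {
  ob :> Type;
  hom : ob -> ob -> Type;
  heq : forall X Y, hom X Y -> hom X Y -> Prop;
  idm : forall X, hom X X;
  comp : forall X Y Z, hom Y Z -> hom X Y -> hom X Z;
  sh : ob -> ob;
  shm : forall X Y, hom X Y -> hom (sh X) (sh Y);
  heq_refl : forall X Y (f : hom X Y), heq f f;
  heq_sym : forall X Y (f g : hom X Y), heq f g -> heq g f;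
  heq_trans : forall X Y (f g h : hom X Y), heq f g -> heq g h -> heq f h;
  comp_heq : forall X Y Z (g g' : hom Y Z) (f f' : hom X Y),
    heq g g' -> heq f f' -> heq (comp g f) (comp g' f');
  compA : forall X Y Z W (h : hom Z W) (g : hom Y Z) (f : hom X Y),
    heq (comp h (comp g f)) (comp (comp h g) f);
  comp1m : forall X Y (f : hom X Y), heq (comp (idm Y) f) f;
  compm1 : forall X Y (f : hom X Y), heq (comp f (idm X)) f;
  shm_heq : forall X Y (f g : hom X Y), heq f g -> heq (shm f) (shm g);
  shm_id : forall X, heq (shm (idm X)) (idm (sh X));
  shm_comp : forall X Y Z (g : hom Y Z) (f : hom X Y),
    heq (shm (comp g f)) (comp (shm g) (shm f))
}.

Arguments idm {s} X.

Section ShiftCatTheory.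
Variable C : shiftCat.

Definition is_iso (X Y : C) (f : hom X Y) : Prop :=
  exists g : hom Y X, heq (comp g f) (idm X) /\ heq (comp f g) (idm Y).

Definition isomorphic (X Y : C) : Prop := exists f : hom X Y, is_iso f.

Definition is_coproduct m (X : 'I_m -> C) (Z : C)
    (inj : forall a, hom (X a) Z) : Prop :=
  forall (W : C) (f : forall a, hom (X a) W),
    exists2 u : hom Z W, (forall a, heq (comp u (inj a)) (f a)) &
      forall v : hom Z W, (forall a, heq (comp v (inj a)) (f a)) -> heq v u.

Definition tri_iso (X Y Z X' Y' Z' : C)
    (f : hom X Y) (g : hom Y Z) (h : hom Z (sh X))
    (f' : hom X' Y') (g' : hom Y' Z') (h' : hom Z' (sh X')) : Prop :=
  exists (a : hom X X') (b : hom Y Y') (c : hom Z Z'),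
    [/\ is_iso a, is_iso b & is_iso c] /\
    [/\ heq (comp b f) (comp f' a), heq (comp c g) (comp g' b) &
        heq (comp (shm a) h) (comp h' c)].

End ShiftCatTheory.

(* The data of a triangulated category.  The axioms of triangulated categories
   are not recorded: they play no role in the definitions below, which are
   only applied to the homotopy category of complexes and its Verdier
   quotients. *)
Record triCat := TriCat {
  tri_cat :> shiftCat;
  dist : forall X Y Z : tri_cat, hom X Y -> hom Y Z -> hom Z (sh X) -> Prop
}.

Section Generation.
Variable T : triCat.

(* A full subcategory is a predicate on objects.  Closure under all shifts
   [X[i]], [i] an integer, is closure under [X |-> X[1]] together with closure
   under desuspension; [m = 0] in [clo_coprod] gives the zero object. *)
Inductive clo (I : T -> Prop) : T -> Prop :=
| clo_in X : I X -> clo I X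
| clo_iso X Y : isomorphic X Y -> clo I X -> clo I Y
| clo_sh X : clo I X -> clo I (sh X)
| clo_unsh X : clo I (sh X) -> clo I X
| clo_coprod m (X : 'I_m -> T) (Z : T) (inj : forall a, hom (X a) Z) :
    is_coproduct inj -> (forall a, clo I (X a)) -> clo I Z
| clo_summand m (X : 'I_m -> T) (Z : T) (inj : forall a, hom (X a) Z) :
    is_coproduct inj -> clo I Z -> forall a, clo I (X a).

Definition star (I1 I2 : T -> Prop) (B : T) : Prop :=
  exists (B1 B2 : T) (f : hom B1 B) (g : hom B B2) (h : hom B2 (sh B1)),
    [/\ dist f g h, I1 B1 & I2 B2].

Definition diamond (I1 I2 : T -> Prop) : T -> Prop := clo (star I1 I2).

Fixpoint gen (I : T -> Prop) (n : nat) : T -> Prop :=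
  if n is m.+1 then diamond (gen I m) (clo I) else clo I.

Definition generates (G : T) (n : nat) : Prop :=
  forall X : T, gen (fun Y => Y = G) n X.

Definition generation_time (G : T) (n : nat) : Prop :=
  generates G n /\ forall m, generates G m -> (n <= m)%N.

Definition Orlov_spectrum (n : nat) : Prop :=
  exists G : T, generation_time G n.

End Generation.

Section Verdier.
Variables (T : triCat) (N : T -> Prop).

(* The morphisms with cone in [N].  When [T] is triangulated and [N] is stable
   under shift, they are already closed under shift; building this closure
   into the definition makes the shift of a formal inverse well defined. *)
Inductive cone_in : forall X Y : T, hom X Y -> Prop :=
| cone_in_dist X Y Z (f : hom X Y) (g : hom Y Z) (h : hom Z (sh X)) :
    dist f g h -> N Z -> cone_in f
| cone_in_sh X Y (f : hom X Y) : cone_in f -> cone_in (shm f).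

(* The localization of [T] at these morphisms, by generators and relations
   (Gabriel-Zisman). *)
Inductive loc_hom : T -> T -> Type :=
| loc_mor X Y (f : hom X Y) : loc_hom X Y
| loc_inv X Y (s : hom X Y) : cone_in s -> loc_hom Y X
| loc_comp X Y Z (g : loc_hom Y Z) (f : loc_hom X Y) : loc_hom X Z.

Inductive loc_heq : forall X Y : T, loc_hom X Y -> loc_hom X Y -> Prop :=
| loc_refl X Y (f : loc_hom X Y) : loc_heq f f
| loc_sym X Y (f g : loc_hom X Y) : loc_heq f g -> loc_heq g f
| loc_trans X Y (f g h : loc_hom X Y) :
    loc_heq f g -> loc_heq g h -> loc_heq f h
| loc_congr X Y Z (g g' : loc_hom Y Z) (f f' : loc_hom X Y) :
    loc_heq g g' -> loc_heq f f' -> loc_heq (loc_comp g f) (loc_comp g' f')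
| loc_assoc X Y Z W (h : loc_hom Z W) (g : loc_hom Y Z) (f : loc_hom X Y) :
    loc_heq (loc_comp h (loc_comp g f)) (loc_comp (loc_comp h g) f)
| loc_1m X Y (f : loc_hom X Y) : loc_heq (loc_comp (loc_mor (idm Y)) f) f
| loc_m1 X Y (f : loc_hom X Y) : loc_heq (loc_comp f (loc_mor (idm X))) f
| loc_mor_heq X Y (f g : hom X Y) :
    heq f g -> loc_heq (loc_mor f) (loc_mor g)
| loc_mor_comp X Y Z (g : hom Y Z) (f : hom X Y) :
    loc_heq (loc_mor (comp g f)) (loc_comp (loc_mor g) (loc_mor f))
| loc_invK X Y (s : hom X Y) (Ss : cone_in s) :
    loc_heq (loc_comp (loc_inv Ss) (loc_mor s)) (loc_mor (idm X))
| loc_Kinv X Y (s : hom X Y) (Ss : cone_in s) :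
    loc_heq (loc_comp (loc_mor s) (loc_inv Ss)) (loc_mor (idm Y)).

Fixpoint loc_sh X Y (f : loc_hom X Y) : loc_hom (sh X) (sh Y) :=
  match f with
  | loc_mor _ _ f => loc_mor (shm f)
  | loc_inv _ _ _ Ss => loc_inv (cone_in_sh Ss)
  | loc_comp _ _ _ g f => loc_comp (loc_sh g) (loc_sh f)
  end.

Fact loc_sh_id X : loc_heq (loc_sh (loc_mor (idm X))) (loc_mor (idm (sh X))).
Proof. exact: loc_mor_heq (shm_id _). Qed.

Fact loc_sh_heq X Y (f g : loc_hom X Y) :
  loc_heq f g -> loc_heq (loc_sh f) (loc_sh g).
Proof.
elim=> {X Y f g} /=.
- by move=> *; apply: loc_refl.
- by move=> *; apply: loc_sym.
- by move=> X Y f g h _ fg _ gh; apply: loc_trans fg gh.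
- by move=> *; apply: loc_congr.
- by move=> *; apply: loc_assoc.
- move=> X Y f; apply: (loc_trans _ (loc_1m _)).
  exact: loc_congr (loc_sh_id _) (loc_refl _).
- move=> X Y f; apply: (loc_trans _ (loc_m1 _)).
  exact: loc_congr (loc_refl _) (loc_sh_id _).
- by move=> X Y f g fg; apply: loc_mor_heq; apply: shm_heq.
- move=> X Y Z g f; apply: loc_trans (loc_mor_comp _ _).
  exact: loc_mor_heq (shm_comp _ _).
- move=> X Y s Ss; apply: loc_trans (loc_invK (cone_in_sh Ss)) _.
  exact: loc_sym (loc_sh_id _).
- move=> X Y s Ss; apply: loc_trans (loc_Kinv (cone_in_sh Ss)) _.
  exact: loc_sym (loc_sh_id _).
Qed.

Definition verdier_cat : shiftCat :=
  @ShiftCat T loc_hom loc_heq (fun X => loc_mor (idm X)) loc_comp (@sh T)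
    loc_sh loc_refl loc_sym loc_trans loc_congr loc_assoc loc_1m loc_m1
    loc_sh_heq loc_sh_id (fun _ _ _ _ _ => loc_refl _).

Definition verdier_dist (X Y Z : verdier_cat)
    (f : hom X Y) (g : hom Y Z) (h : hom Z (sh X)) : Prop :=
  exists (X' Y' Z' : T) (f' : hom X' Y') (g' : hom Y' Z') (h' : hom Z' (sh X')),
    dist f' g' h' /\
    @tri_iso verdier_cat _ _ _ _ _ _ f g h
      (loc_mor f') (loc_mor g') (loc_mor h').

Definition verdier : triCat := TriCat verdier_dist.

End Verdier.

Section Modules.
Variable S : comNzRingType.

Definition fin_gen (M : lmodType S) : Prop :=
  exists m (e : 'I_m -> M), forall x, exists c : 'I_m -> S,
    x = \sum_(i < m) c i *: e i.

Definition projective (P : lmodType S) : Prop :=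
  forall (M N : lmodType S) (p : {linear M -> N}) (g : {linear P -> N}),
    (forall y, exists x, p x = y) ->
    exists f : {linear P -> M}, forall x, p (f x) = g x.

Record cpx := Cpx {
  term :> int -> lmodType S;
  diff : forall i : int, {linear term i -> term (i + 1)};
  _ : forall (i : int) x, diff (i + 1) (diff i x) = 0;
  _ : forall i : int, fin_gen (term i);
  _ : exists b : nat, forall i : int, (b < `|i|)%N -> forall x : term i, x = 0
}.

Arguments diff : clear implicits.

Lemma diffK (X : cpx) (i : int) x : diff X (i + 1) (diff X i x) = 0.
Proof. by case: X i x. Qed.

Lemma term_fin_gen (X : cpx) (i : int) : fin_gen (X i).
Proof. by case: X i. Qed.

Lemma cpx_bounded (X : cpx) :
  exists b : nat, forall i : int, (b < `|i|)%N -> forall x : X i, x = 0.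
Proof. by case: X. Qed.

Fact shifted_bounded (X : cpx) :
  exists b : nat, forall i : int, (b < `|i|)%N -> forall x : X (i + 1), x = 0.
Proof.
have [b Xb] := cpx_bounded X; exists b.+1 => i lt_bi.
by apply: Xb; rewrite -ltnS (leq_trans lt_bi) //; lia.
Qed.

Definition shift_diff (X : cpx) (i : int) :
    {linear X (i + 1) -> X (i + 1 + 1)} :=
  \- diff X (i + 1).

Fact shift_diffK (X : cpx) (i : int) x :
  shift_diff X (i + 1) (shift_diff X i x) = 0.
Proof. by rewrite /= linearN opprK; exact: diffK. Qed.

Definition shift (X : cpx) : cpx :=
  @Cpx (fun i : int => X (i + 1)) (shift_diff X) (shift_diffK (X := X))
    (fun i : int => term_fin_gen X (i + 1)) (shifted_bounded X).

Record cmap (X Y : cpx) := Cmap {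
  cfun :> forall i : int, {linear X i -> Y i};
  _ : forall (i : int) x, cfun (i + 1) (diff X i x) = diff Y i (cfun i x)
}.

Lemma cmapE (X Y : cpx) (f : cmap X Y) (i : int) x :
  f (i + 1) (diff X i x) = diff Y i (f i x).
Proof. by case: f i x. Qed.

(* A homotopy is indexed as h^(i+1) : X^(i+1) -> Y^i, and the relation
   f - g = d h + h d is written in degree i + 1; as i ranges over all integers,
   this covers every degree. *)
Definition homotopic (X Y : cpx) (f g : cmap X Y) : Prop :=
  exists h : forall i : int, {linear X (i + 1) -> Y i},
    forall (i : int) (x : X (i + 1)),
      f (i + 1) x - g (i + 1) x
        = diff Y i (h i x) + h (i + 1) (diff X (i + 1) x).

Definition cmap_id (X : cpx) : cmap X X :=
  @Cmap X X (fun i : int => idfun) (fun i x => erefl).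

Fact cmap_comp_subproof (X Y Z : cpx) (g : cmap Y Z) (f : cmap X Y)
    (i : int) x :
  (g (i + 1) \o f (i + 1)) (diff X i x) = diff Z i ((g i \o f i) x).
Proof. by rewrite /= !cmapE. Qed.

Definition cmap_comp (X Y Z : cpx) (g : cmap Y Z) (f : cmap X Y) : cmap X Z :=
  @Cmap X Z (fun i : int => g i \o f i) (cmap_comp_subproof g f).

Fact cmap_shift_subproof (X Y : cpx) (f : cmap X Y) (i : int) (x : shift X i) :
  f (i + 1 + 1) (diff (shift X) i x) = diff (shift Y) i (f (i + 1) x).
Proof. by rewrite /= linearN; congr (- _); exact: cmapE. Qed.

Definition cmap_shift (X Y : cpx) (f : cmap X Y) : cmap (shift X) (shift Y) :=
  @Cmap (shift X) (shift Y) (fun i : int => f (i + 1)) (cmap_shift_subproof f).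

Lemma cmap_eq_homotopic (X Y : cpx) (f g : cmap X Y) :
  (forall (i : int) x, f i x = g i x) -> homotopic f g.
Proof.
move=> fg; exists (fun i : int => \0) => i x.
by rewrite /= fg subrr raddf0 addr0.
Qed.

Fact homotopic_refl (X Y : cpx) (f : cmap X Y) : homotopic f f.
Proof. exact: cmap_eq_homotopic. Qed.

Fact homotopic_sym (X Y : cpx) (f g : cmap X Y) :
  homotopic f g -> homotopic g f.
Proof.
case=> h hE; exists (fun i : int => \- h i) => i x /=.
by rewrite (raddfN (diff Y i)) -opprD -hE opprB.
Qed.

Fact homotopic_trans (X Y : cpx) (f g h : cmap X Y) :
  homotopic f g -> homotopic g h -> homotopic f h.
Proof.
case=> a aE [b bE]; exists (fun i : int => a i \+ b i) => i x /=.
by rewrite raddfD addrACA -aE -bE addrA subrK.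
Qed.

Fact homotopic_comp (X Y Z : cpx) (g g' : cmap Y Z) (f f' : cmap X Y) :
  homotopic g g' -> homotopic f f' ->
  homotopic (cmap_comp g f) (cmap_comp g' f').
Proof.
case=> a aE [b bE].
exists (fun i : int => (a i \o f (i + 1)) \+ (g' i \o b i)) => i x /=.
rewrite linearD addrACA -!cmapE (cmapE f) -aE -linearD -bE linearB.
by rewrite addrA subrK.
Qed.

Fact homotopic_shift (X Y : cpx) (f g : cmap X Y) :
  homotopic f g -> homotopic (cmap_shift f) (cmap_shift g).
Proof.
case=> h hE; exists (fun i : int => \- h (i + 1)) => i x /=.
rewrite linearN opprK linearN opprK; exact: hE.
Qed.

Definition homotopy_cat : shiftCat.
Proof.
refine (@ShiftCat cpx cmap homotopic cmap_id cmap_comp shift cmap_shift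
  homotopic_refl homotopic_sym homotopic_trans homotopic_comp
  _ _ _ homotopic_shift _ _) => *; exact: cmap_eq_homotopic.
Defined.

Section Cone.
Variables (X Y : cpx) (f : cmap X Y).

Definition cone_term (i : int) : lmodType S := (X (i + 1)%R * Y i)%type.

(* Sign conventions: the differential of X[1] is - d, that of the cone is
   (x, y) |-> (- d x, f x + d y), and the triangle is X -> Y -> cone -> X[1]
   with the canonical maps. *)
Definition cone_fun (i : int) (z : cone_term i) : cone_term (i + 1) :=
  (- diff X (i + 1) z.1, f (i + 1) z.1 + diff Y i z.2).

Fact cone_fun_linear (i : int) : linear (@cone_fun i).
Proof.
move=> a z w; rewrite /cone_fun /=; congr pair.
  by rewrite linearP opprD /= scalerN.
by rewrite !linearP /= scalerDr addrACA.
Qed.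

HB.instance Definition _ (i : int) :=
  GRing.isLinear.Build S (cone_term i) (cone_term (i + 1)) _ (@cone_fun i)
    (@cone_fun_linear i).

Definition cone_diff (i : int) : {linear cone_term i -> cone_term (i + 1)} :=
  @cone_fun i.

Fact cone_diffK (i : int) z : cone_diff (i + 1) (cone_diff i z) = 0.
Proof.
rewrite /cone_diff /= /cone_fun /=; congr pair.
  by rewrite linearN opprK; exact: diffK.
by rewrite linearN linearD diffK addr0 cmapE addNr.
Qed.

Fact cone_fin_gen (i : int) : fin_gen (cone_term i).
Proof.
have [m [e eP]] := term_fin_gen X (i + 1).
have [p [u uP]] := term_fin_gen Y i.
exists (m + p)%N, (fun j : 'I_(m + p) =>
  match split j with inl a => (e a, 0) | inr b => (0, u b) end).
case=> x y; have [c ->] := eP x; have [v ->] := uP y.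
exists (fun j => match split j with inl a => c a | inr b => v b end).
rewrite big_split_ord /=; congr pair; rewrite !raddf_sum /=.
  rewrite [X in _ = _ + X]big1 ?addr0 => [|b _]; last first.
    by rewrite (unsplitK (inr b)) /= scaler0.
  by apply: eq_bigr => a _; rewrite (unsplitK (inl a)).
rewrite [X in _ = X + _]big1 ?add0r => [|a _]; last first.
  by rewrite (unsplitK (inl a)) /= scaler0.
by apply: eq_bigr => b _; rewrite (unsplitK (inr b)).
Qed.

Fact cone_bounded :
  exists b : nat, forall i : int, (b < `|i|)%N -> forall z : cone_term i, z = 0.
Proof.
have [b Xb] := shifted_bounded X; have [c Yc] := cpx_bounded Y.
exists (maxn b c) => i; rewrite gtn_max => /andP[bi ci] [x y].
by rewrite (Xb i bi x) (Yc i ci y).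
Qed.

Definition cone : cpx := Cpx cone_diffK cone_fin_gen cone_bounded.

Definition cone_in_fun (i : int) (y : Y i) : cone i := (0, y).
Definition cone_out_fun (i : int) (z : cone i) : shift X i := z.1.

Fact cone_in_linear (i : int) : linear (@cone_in_fun i).
Proof. by move=> a y y'; congr pair; rewrite /= scaler0 addr0. Qed.

Fact cone_out_linear (i : int) : linear (@cone_out_fun i).
Proof. by []. Qed.

HB.instance Definition _ (i : int) :=
  GRing.isLinear.Build S (Y i) (cone i) _ (@cone_in_fun i) (@cone_in_linear i).

HB.instance Definition _ (i : int) :=
  GRing.isLinear.Build S (cone i) (shift X i) _ (@cone_out_fun i)
    (@cone_out_linear i).

Fact cone_in_subproof (i : int) (y : Y i) :
  cone_in_fun (diff Y i y) = diff cone i (cone_in_fun y).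
Proof. by congr pair; rewrite /= ?raddf0 ?oppr0 ?add0r. Qed.

Definition cone_incl : cmap Y cone :=
  @Cmap Y cone (fun i : int => @cone_in_fun i) cone_in_subproof.

Definition cone_proj : cmap cone (shift X) :=
  @Cmap cone (shift X) (fun i : int => @cone_out_fun i) (fun i z => erefl).

End Cone.

Definition cone_dist (X Y Z : homotopy_cat)
    (f : hom X Y) (g : hom Y Z) (h : hom Z (sh X)) : Prop :=
  exists (X' Y' : cpx) (u : cmap X' Y'),
    @tri_iso homotopy_cat _ _ _ _ _ _ f g h u (cone_incl u) (cone_proj u).

Definition Kb : triCat := TriCat cone_dist.

(* The definitions make sense for every S, but finitely generated modules form
   an abelian category, as intended, only when S is Noetherian. *)

Definition acyclic (X : cpx) : Prop :=
  forall (i : int) (x : X (i + 1)), diff X (i + 1) x = 0 ->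
    exists y, diff X i y = x.

Definition Db : triCat := verdier (T := Kb) acyclic.

(* Objects of [Db] are already bounded complexes of finitely generated
   modules. *)
Definition perfect (X : cpx) : Prop := forall i : int, projective (X i).

Definition Dsg : triCat := verdier (T := Db) perfect.

End Modules.

(* Main.v *)
(* Let [u] be the class of [X], [m = n./2], and write [M_p] for the cyclic
   module of length [p]; then [M_p[1] = M_(n - p)] in the singularity category,
   and every object is a finite sum of shifts of the [M_p].

   Lower bound: a suitable Tate cohomology functor turns triangles into exact
   sequences of modules over [k[u]].  If [u ^+ s] kills the cohomology of [G]
   and of its shifts, then [u ^+ (t.+1 * s)] kills that of every object built
   from [G] in [t] steps, whereas the cohomology of [M_m] is killed by no power
   below [u ^+ m].  Hence [m <= t.+1 * s], where [s] is the largest value of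
   [min (p, n - p)] over the summands [M_p] of [G].

   Upper bound: [M_s] is a summand of [G] up to shift, and the exact sequences
   [0 -> M_(r+k) -> M_(q+k) (+) M_r -> M_q -> 0] produce from [M_s] all [M_p]
   with [p <= t.+1 * s] in [t] steps, provided that [t > 0].  So the generation
   time of [G] is the least [t] with [m <= t.+1 * s], except that it may be 1
   when [s = m]; if so [m > 1], and 1 is also the value obtained for
   [s = m - 1]. *)

Require Import Defs.
From Corelib Require Import Setoid Morphisms.
From HB Require Import structures.
From mathcomp Require Import all_boot all_order all_algebra.
From mathcomp Require Import boolp zify.
(* Defs is imported again because all_boot shadows [comp]. *)
Import Defs.

Set Implicit Arguments.
Unset Strict Implicit.
Unset Printing Implicit Defensive.

Import Order.TTheory GRing.Theory Num.Theory.
Local Open Scope ring_scope.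

(** * Categories with shift and Verdier localization *)

(** The obstacle is that [Dsg] is localized twice, by generators and relations: neither the axioms
    of triangulated categories nor a calculus of fractions is at hand. Hence triangles, sums and
    isomorphisms are built from explicit complexes in [Kb], while coproducts and homological
    functors are carried through each localization by induction on words in morphisms and formal
    inverses. The functor must vanish on acyclic and on perfect complexes to survive both
    localizations; tensoring bounded complexes with an exact two-sided sequence of free modules
    achieves this. Its differentials u^m and u^(n-m) both kill M_m, because m <= n - m, so the
    cohomology of M_m is M_m itself. The condition t > 0 enters the upper bound because with no cone
    at all M_m may be present without the shorter M_p, which one step supplies. Conversely, the
    value attached to s is attained by the sum of all M_p with p <= min(s, m). *)

#[export] Instance heq_equiv (C : shiftCat) (X Y : C) :
  Equivalence (@heq C X Y).
Proof. split; [exact: heq_refl | exact: heq_sym | exact: heq_trans]. Qed.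

#[export] Instance comp_proper (C : shiftCat) (X Y Z : C) :
  Proper (@heq C Y Z ==> @heq C X Y ==> @heq C X Z) (@comp C X Y Z).
Proof. by move=> g g' gg f f' ff; apply: comp_heq. Qed.

#[export] Instance shm_proper (C : shiftCat) (X Y : C) :
  Proper (@heq C X Y ==> @heq C (sh X) (sh Y)) (@shm C X Y).
Proof. by move=> f f' ff; apply: shm_heq. Qed.

#[export] Hint Extern 0 (heq _ _) => reflexivity : core.

Local Notation "g ** f" := (comp g f) (at level 40, left associativity).
Local Notation "f =~ g" := (heq f g) (at level 70).

Section Isomorphisms.
Variable C : shiftCat.
Implicit Types X Y Z : C.

Lemma is_iso_id X : is_iso (idm X).
Proof. by exists (idm X); rewrite comp1m. Qed.

Lemma is_iso_comp X Y Z (g : hom Y Z) (f : hom X Y) :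
  is_iso g -> is_iso f -> is_iso (g ** f).
Proof.
move=> [g' [gK Kg]] [f' [fK Kf]]; exists (f' ** g'); split.
  by rewrite compA -(compA f') gK compm1 fK.
by rewrite compA -(compA g) Kf compm1 Kg.
Qed.

Lemma is_iso_shm X Y (f : hom X Y) : is_iso f -> is_iso (shm f).
Proof.
by move=> [g [fK Kf]]; exists (shm g); rewrite -!shm_comp fK Kf !shm_id.
Qed.

Lemma isomorphic_sym X Y : isomorphic X Y -> isomorphic Y X.
Proof. by move=> [f [g [fK Kf]]]; exists g, f. Qed.

Lemma isomorphic_trans X Y Z :
  isomorphic X Y -> isomorphic Y Z -> isomorphic X Z.
Proof. by move=> [f fP] [g gP]; exists (g ** f); apply: is_iso_comp. Qed.

Lemma tri_iso_trans X1 Y1 Z1 X2 Y2 Z2 X3 Y3 Z3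
    (f1 : hom X1 Y1) (g1 : hom Y1 Z1) (h1 : hom Z1 (sh X1))
    (f2 : hom X2 Y2) (g2 : hom Y2 Z2) (h2 : hom Z2 (sh X2))
    (f3 : hom X3 Y3) (g3 : hom Y3 Z3) (h3 : hom Z3 (sh X3)) :
  tri_iso f1 g1 h1 f2 g2 h2 -> tri_iso f2 g2 h2 f3 g3 h3 ->
  tri_iso f1 g1 h1 f3 g3 h3.
Proof.
move=> [a [b [c [[aI bI cI] [fE gE hE]]]]].
move=> [a' [b' [c' [[aI' bI' cI'] [fE' gE' hE']]]]].
exists (a' ** a), (b' ** b), (c' ** c); split.
  by split; apply: is_iso_comp.
split.
- by rewrite -compA fE compA fE' compA.
- by rewrite -compA gE compA gE' compA.
- by rewrite shm_comp -compA hE compA hE' compA.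
Qed.

Lemma tri_iso_refl X Y Z (f : hom X Y) (g : hom Y Z) (h : hom Z (sh X)) :
  tri_iso f g h f g h.
Proof.
exists (idm X), (idm Y), (idm Z); split; first by split; apply: is_iso_id.
by split; rewrite ?shm_id comp1m compm1.
Qed.

End Isomorphisms.

Definition iso_closed (T : triCat) : Prop :=
  forall (X Y Z X' Y' Z' : T)
    (f : hom X Y) (g : hom Y Z) (h : hom Z (sh X))
    (f' : hom X' Y') (g' : hom Y' Z') (h' : hom Z' (sh X')),
  tri_iso f g h f' g' h' -> dist f' g' h' -> dist f g h.

(** Only the square of first maps has to be checked: the other two maps are defined by conjugation,
    which makes their squares commute. *)
Lemma dist_conj (T : triCat) (X Y Z X' Y' Z' : T)
    (f' : hom X' Y') (g' : hom Y' Z') (h' : hom Z' (sh X'))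
    (f : hom X Y) (a : hom X X') (b : hom Y Y') (c : hom Z Z') :
  iso_closed T ->
  dist f' g' h' -> is_iso a -> is_iso b -> is_iso c -> b ** f =~ f' ** a ->
  exists (g : hom Y Z) (h : hom Z (sh X)), dist f g h.
Proof.
move=> Tiso D aI bI cI E; have [a' [aK Ka]] := aI; have [c' [cK Kc]] := cI.
exists (c' ** g' ** b), (shm a' ** h' ** c); apply: Tiso D.
exists a, b, c; split=> //; split=> //.
  by rewrite !compA Kc comp1m.
by rewrite !compA -shm_comp Ka shm_id comp1m.
Qed.

(** Two properties of triangles that pass to Verdier quotients, hence from [Kb] to [Db] and [Dsg].
    In [dist_sh] the last two maps are left open: [cone_in] sees only the first map and the cone, so
    no rotation signs arise. *)
Record tri_ok (T : triCat) : Prop := TriOk {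
  dist_iso : iso_closed T;
  dist_sh : forall (X Y Z : T) (f : hom X Y) (g : hom Y Z) (h : hom Z (sh X)),
    dist f g h ->
    exists (g' : hom (sh Y) (sh Z)) (h' : hom (sh Z) (sh (sh X))),
      dist (shm f) g' h'
}.

Section Localization.
Variable T : triCat.
Hypothesis Tok : tri_ok T.
Variable N : T -> Prop.
Hypothesis N_sh : forall X, N X -> N (sh X).

(** Triangles and [N] are both stable under shift, so the shift closure built into [cone_in] adds no
    morphism. *)
Lemma cone_inE (X Y : T) (f : hom X Y) : cone_in N f ->
  exists (Z : T) (g : hom Y Z) (h : hom Z (sh X)), dist f g h /\ N Z.
Proof.
elim=> {X Y f} [X Y Z f g h fgh NZ | X Y f _ [Z [g [h [fgh NZ]]]]].
  by exists Z, g, h.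
have [g' [h' D]] := dist_sh Tok fgh.
by exists (sh Z), g', h'; split=> //; apply: N_sh.
Qed.

Local Notation L := (verdier N).
Definition mor (X Y : T) (f : hom X Y) : @hom L X Y := loc_mor N f.

#[export] Instance mor_proper (X Y : T) :
  Proper (@heq T X Y ==> @heq L X Y) (@mor X Y).
Proof. by move=> f g fg; apply: loc_mor_heq. Qed.

Lemma mor_comp (X Y Z : T) (g : hom Y Z) (f : hom X Y) :
  mor (g ** f) =~ mor g ** mor f.
Proof. exact: loc_mor_comp. Qed.

Lemma mor_id (X : T) : mor (idm X) =~ idm (X : L).
Proof. exact: loc_refl. Qed.

Lemma mor_iso (X Y : T) (f : hom X Y) : is_iso f -> is_iso (mor f).
Proof.
by move=> [g [fK Kf]]; exists (mor g); rewrite -!mor_comp fK Kf !mor_id.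
Qed.

Lemma mor_cone_in (X Y : T) (f : hom X Y) : cone_in N f -> is_iso (mor f).
Proof.
by move=> Nf; exists (loc_inv Nf); split; [apply: loc_invK|apply: loc_Kinv].
Qed.

Lemma mor_dist (X Y Z : T) (f : hom X Y) (g : hom Y Z) (h : hom Z (sh X)) :
  dist f g h -> @dist L _ _ _ (mor f) (mor g) (mor h).
Proof.
by move=> D; exists X, Y, Z, f, g, h; split=> //; apply: tri_iso_refl.
Qed.

Lemma verdier_dist_iso : iso_closed L.
Proof.
move=> X Y Z X' Y' Z' f g h f' g' h' I [X1 [Y1 [Z1 [f1 [g1 [h1 [D I1]]]]]]].
exists X1, Y1, Z1, f1, g1, h1; split=> //.
exact: (tri_iso_trans (C := L)) I I1.
Qed.

Lemma verdier_ok : tri_ok L.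
Proof.
split; first exact: verdier_dist_iso.
move=> X Y Z f g h [X1 [Y1 [Z1 [f1 [g1 [h1 [D [a [b [c [[aI bI cI] [E _
  _]]]]]]]]]]]].
have [g' [h' /mor_dist D']] := dist_sh Tok D.
have [a' [aK Ka]] := aI; have [c' [cK Kc]] := cI.
exists (shm c' ** mor g' ** shm b), (shm (shm a') ** mor h' ** shm c).
apply: verdier_dist_iso D'; exists (shm a), (shm b), (shm c); split.
  by split; apply: is_iso_shm.
split.
- by rewrite -shm_comp E shm_comp.
- by rewrite !compA -(shm_comp c) Kc shm_id comp1m.
- by rewrite !compA -!shm_comp Ka !shm_id comp1m.
Qed.

End Localization.

(** * Coproducts in a localization *)

Record coprods (T : triCat) := Coprods {
  zero : T;
  init : forall X, hom zero X;
  init_uniq : forall X (f g : hom zero X), f =~ g;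
  sum : T -> T -> T;
  in1 : forall X Y, hom X (sum X Y);
  in2 : forall X Y, hom Y (sum X Y);
  cop : forall X Y Z, hom X Z -> hom Y Z -> hom (sum X Y) Z;
  cop_in1 : forall X Y Z (f : hom X Z) (g : hom Y Z), cop f g ** in1 X Y =~ f;
  cop_in2 : forall X Y Z (f : hom X Z) (g : hom Y Z), cop f g ** in2 X Y =~ g;
  cop_uniq : forall X Y Z (u v : hom (sum X Y) Z),
    u ** in1 X Y =~ v ** in1 X Y -> u ** in2 X Y =~ v ** in2 X Y -> u =~ v
}.

Arguments init {T} c X.
Arguments in1 {T} c X Y.
Arguments in2 {T} c X Y.
Arguments cop {T} c {X Y Z} f g.
Arguments sum {T} c X Y.

Definition sumr (T : triCat) (c : coprods T) (W X Y : T) (f : hom X Y) :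
    hom (sum c X W) (sum c Y W) :=
  cop c (in1 c Y W ** f) (in2 c Y W).

(** The cone of [f (+) id_W] is that of [f]. Thus [- (+) W] preserves the inverted morphisms and
    extends to the localization. *)
Definition sum_exact (T : triCat) (c : coprods T) : Prop :=
  forall (X Y Z : T) (f : hom X Y) (g : hom Y Z) (h : hom Z (sh X)),
  dist f g h -> forall W,
  exists (g' : hom (sum c Y W) Z) (h' : hom Z (sh (sum c X W))),
    dist (sumr c W f) g' h'.

Section CoproductFunctor.
Variables (T : triCat) (c : coprods T).

Lemma sumr_heq (W X Y : T) (f g : hom X Y) :
  f =~ g -> sumr c W f =~ sumr c W g.
Proof.
by move=> fg; apply: (cop_uniq (c := c)); rewrite /sumr ?cop_in1 ?cop_in2 ?fg.
Qed.

Lemma sumr_id (W X : T) : sumr c W (idm X) =~ idm (sum c X W).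
Proof.
by apply: (cop_uniq (c := c)); rewrite /sumr ?cop_in1 ?cop_in2 ?comp1m ?compm1.
Qed.

Lemma sumr_comp (W X Y Z : T) (g : hom Y Z) (f : hom X Y) :
  sumr c W (g ** f) =~ sumr c W g ** sumr c W f.
Proof.
apply: (cop_uniq (c := c)); rewrite /sumr -compA ?cop_in1 ?cop_in2 //.
by rewrite [X in _ =~ X]compA cop_in1 -compA.
Qed.

Lemma sumr_iso (W X Y : T) (f : hom X Y) : is_iso f -> is_iso (sumr c W f).
Proof.
by case=> g [fK Kf]; exists (sumr c W g); rewrite -!sumr_comp (sumr_heq W fK)
  (sumr_heq W Kf) !sumr_id.
Qed.

End CoproductFunctor.

Section LocalizationCoproducts.
Variables (T : triCat) (c : coprods T) (N : T -> Prop).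
Hypothesis sum_dist : sum_exact c.
Hypothesis Tok : tri_ok T.
Hypothesis N_sh : forall X, N X -> N (sh X).

Local Notation L := (verdier N).
Local Notation "X (+) Y" := (sum c X Y) (at level 50, left associativity).
Local Notation i1 := (in1 c _ _).
Local Notation i2 := (in2 c _ _).

Lemma cone_in_sumr (X Y W : T) (s : hom X Y) :
  cone_in N s -> cone_in N (sumr c W s).
Proof.
move=> /(cone_inE Tok N_sh) [Z [g [h [D NZ]]]].
by have [g' [h' D']] := sum_dist D W; apply: cone_in_dist D' NZ.
Qed.

Fixpoint lsumr (W X Y : T) (f : loc_hom N X Y) :
    loc_hom N (X (+) W) (Y (+) W) :=
  match f with
  | loc_mor _ _ f => loc_mor N (sumr c W f)
  | loc_inv _ _ _ Ns => loc_inv (cone_in_sumr W Ns)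
  | loc_comp _ _ _ g f => loc_comp (lsumr W g) (lsumr W f)
  end.

Lemma lsumr_heq (W X Y : T) (f g : loc_hom N X Y) :
  loc_heq f g -> loc_heq (lsumr W f) (lsumr W g).
Proof.
have lsumr_id (Z : T) : loc_heq (lsumr W (loc_mor N (idm Z)))
                                (loc_mor N (idm (Z (+) W))).
  by exact: loc_mor_heq (sumr_id c W Z).
elim=> {X Y f g} /=.
- by move=> *; apply: loc_refl.
- by move=> *; apply: loc_sym.
- by move=> X Y f g h _ fg _ gh; apply: loc_trans fg gh.
- by move=> *; apply: loc_congr.
- by move=> *; apply: loc_assoc.
- move=> X Y f; apply: (loc_trans _ (loc_1m _)).
  exact: loc_congr (lsumr_id _) (loc_refl _).
- move=> X Y f; apply: (loc_trans _ (loc_m1 _)).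
  exact: loc_congr (loc_refl _) (lsumr_id _).
- by move=> X Y f g fg; apply: loc_mor_heq; apply: sumr_heq.
- move=> X Y Z g f; apply: loc_trans (loc_mor_comp _ _ _).
  exact: loc_mor_heq (sumr_comp c W g f).
- move=> X Y s Ns; apply: loc_trans (loc_invK (cone_in_sumr W Ns)) _.
  exact: loc_sym (lsumr_id _).
- move=> X Y s Ns; apply: loc_trans (loc_Kinv (cone_in_sumr W Ns)) _.
  exact: loc_sym (lsumr_id _).
Qed.

Definition rsum (W : T) (X Y : L) (f : hom X Y) :
  @hom L (X (+) W) (Y (+) W) := lsumr W f.

#[local] Instance rsum_proper (W : T) (X Y : L) :
  Proper (@heq L X Y ==> @heq L (X (+) W) (Y (+) W)) (@rsum W X Y).
Proof. by move=> f g; apply: lsumr_heq. Qed.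

Local Notation mor := (mor N).

Lemma rsum_comp (W : T) (X Y Z : L) (g : hom Y Z) (f : hom X Y) :
  rsum W (g ** f) =~ rsum W g ** rsum W f.
Proof. exact: loc_refl. Qed.

Lemma rsum_mor (W X Y : T) (f : hom X Y) : rsum W (mor f) =~ mor (sumr c W f).
Proof. exact: loc_refl. Qed.

Lemma rsum_id (W : T) (X : L) : rsum W (idm X) =~ idm (X (+) W : L).
Proof. by rewrite -mor_id rsum_mor sumr_id mor_id. Qed.

(** Induction on the word: for a formal inverse [t] of [s], the square of [s] is conjugated by [t]
    and [rsum W t]. *)
Lemma rsum_in1 (W : T) (X Y : L) (f : hom X Y) :
  rsum W f ** mor i1 =~ mor i1 ** f.
Proof.
elim: f => {X Y} [X Y f | X Y s Ns | X Y Z g IHg f IHf].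
- by rewrite -[loc_mor N f]/(mor f) rsum_mor -!mor_comp /sumr cop_in1.
- set t := loc_inv Ns : @hom L Y X.
  have tK : t ** mor s =~ idm (X : L) by apply: loc_invK.
  have Kt : mor s ** t =~ idm (Y : L) by apply: loc_Kinv.
  rewrite -(compm1 (rsum W t ** mor i1)) -Kt compA -(compA (rsum W t)).
  rewrite -mor_comp -(cop_in1 c (i1 ** s) i2) mor_comp -[cop _ _ _]/(sumr c W
    s).
  by rewrite -rsum_mor compA -rsum_comp tK rsum_id comp1m.
- rewrite -[loc_comp g f]/(comp (s := L) g f).
  by rewrite rsum_comp -compA IHf compA IHg compA.
Qed.

Lemma rsum_in2 (W : T) (X Y : L) (f : hom X Y) :
  rsum W f ** mor i2 =~ mor i2.
Proof.
elim: f => {X Y} [X Y f | X Y s Ns | X Y Z g IHg f IHf].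
- by rewrite -[loc_mor N f]/(mor f) rsum_mor -!mor_comp /sumr cop_in2.
- set t := loc_inv Ns : @hom L Y X.
  have tK : t ** mor s =~ idm (X : L) by apply: loc_invK.
  rewrite -(cop_in2 c (i1 ** s) i2) mor_comp -[cop _ _ _]/(sumr c W s).
  rewrite -rsum_mor compA -rsum_comp tK rsum_id.
  by rewrite comp1m.
- rewrite -[loc_comp g f]/(comp (s := L) g f).
  by rewrite rsum_comp -compA IHf IHg.
Qed.

Definition swap (X Y : T) : hom (X (+) Y) (Y (+) X) := cop c i2 i1.

Lemma swapK (X Y : T) : swap Y X ** swap X Y =~ idm (X (+) Y).
Proof.
by apply: (cop_uniq (c := c)); rewrite /swap -compA ?cop_in1 ?cop_in2
  ?cop_in1 ?cop_in2 comp1m.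
Qed.

(* [suml] and [lsum] are locked because otherwise rewriting with [compA]
   unfolds them. *)
Definition suml (W X Y : T) (f : hom X Y) : hom (W (+) X) (W (+) Y) :=
  locked (swap Y W ** sumr c W f ** swap W X).

Definition lsum (W : T) (X Y : L) (f : hom X Y) :
    @hom L (W (+) X) (W (+) Y) :=
  locked (mor (swap Y W) ** rsum W f ** mor (swap W X)).

#[local] Instance lsum_proper (W : T) (X Y : L) :
  Proper (@heq L X Y ==> @heq L (W (+) X) (W (+) Y)) (@lsum W X Y).
Proof. by move=> f g fg; rewrite /lsum -!lock fg. Qed.

Lemma lsum_comp (W : T) (X Y Z : L) (g : hom Y Z) (f : hom X Y) :
  lsum W (g ** f) =~ lsum W g ** lsum W f.
Proof.
rewrite /lsum -!lock rsum_comp !compA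
  -(compA _ (mor (swap W Y))) -mor_comp swapK.
by rewrite mor_id compm1.
Qed.

Lemma lsum_id (W : T) (X : L) : lsum W (idm X) =~ idm (W (+) X : L).
Proof. by rewrite /lsum -!lock rsum_id compm1 -mor_comp swapK mor_id. Qed.

Lemma lsum_mor (W X Y : T) (f : hom X Y) : lsum W (mor f) =~ mor (suml W f).
Proof. by rewrite /lsum /suml -!lock rsum_mor -!mor_comp. Qed.

Lemma lsum_in1 (W : T) (X Y : L) (f : hom X Y) :
  lsum W f ** mor i1 =~ mor i1.
Proof.
rewrite /lsum -!lock -compA -mor_comp /swap cop_in1 -compA rsum_in2 -mor_comp.
by rewrite cop_in2.
Qed.

Lemma lsum_in2 (W : T) (X Y : L) (f : hom X Y) :
  lsum W f ** mor i2 =~ mor i2 ** f.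
Proof.
rewrite /lsum -!lock -compA -mor_comp /swap cop_in2 -compA rsum_in1 compA
  -mor_comp.
by rewrite cop_in1.
Qed.

Lemma sumr_in1 (W X Y : T) (f : hom X Y) : sumr c W f ** i1 =~ i1 ** f.
Proof. exact: cop_in1. Qed.

Lemma sumr_in2 (W X Y : T) (f : hom X Y) : sumr c W f ** i2 =~ i2.
Proof. exact: cop_in2. Qed.

Lemma suml_in1 (W X Y : T) (f : hom X Y) : suml W f ** i1 =~ i1.
Proof. by rewrite /suml -!lock /swap -!compA cop_in1 /sumr cop_in2 cop_in2. Qed.

Lemma suml_in2 (W X Y : T) (f : hom X Y) : suml W f ** i2 =~ i2 ** f.
Proof. by rewrite /suml -!lock /swap -!compA cop_in2 /sumr cop_in1 compA
  cop_in1. Qed.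

Lemma sumC (X Y Z W : T) (v : hom Z W) (g : @hom L X Y) :
  mor (sumr c Y v) ** lsum Z g =~ lsum W g ** mor (sumr c X v).
Proof.
have mor_case (X' Y' : T) (f : hom X' Y') :
    mor (sumr c Y' v) ** mor (suml Z f) =~ mor (suml W f) ** mor (sumr c X' v).
  rewrite -!mor_comp; apply: mor_proper.
  apply: (cop_uniq (c := c)).
    rewrite -(compA (sumr c _ _)) suml_in1 sumr_in1.
    by rewrite -(compA (suml _ _)) sumr_in1 compA suml_in1.
  rewrite -(compA (sumr c _ _)) suml_in2 compA sumr_in2.
  by rewrite -(compA (suml _ _)) sumr_in2 suml_in2.
elim: g => {X Y} [X Y f | X Y s Ns | X Y U g IHg f IHf].
- by rewrite -[loc_mor N f]/(mor f) !lsum_mor.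
- set t := loc_inv Ns : @hom L Y X.
  have tK : t ** mor s =~ idm (X : L) by apply: loc_invK.
  have Kt : mor s ** t =~ idm (Y : L) by apply: loc_Kinv.
  rewrite -(comp1m (mor (sumr c X v) ** _)) -lsum_id -tK lsum_comp lsum_mor.
  rewrite -compA (compA (mor (suml W s))) -mor_case -(compA _ _ (lsum Z t)).
  by rewrite -lsum_mor -lsum_comp Kt lsum_id compm1.
- rewrite -[loc_comp g f]/(comp (s := L) g f).
  by rewrite !lsum_comp compA IHg -compA IHf compA.
Qed.

Definition fold (X : T) : hom (X (+) X) X := cop c (idm X) (idm X).

(* Induction on the word [v].  This naturality makes a morphism out of a sum
   depend only on its two restrictions. *)
Lemma fold_natural (Y Z W : T) (v : @hom L Z W) (g : @hom L Y Z) :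
  v ** mor (fold Z) ** lsum Z g =~ mor (fold W) ** lsum W (v ** g) ** rsum Y v.
Proof.
have mor_case (Y' Z' W' : T) (v' : hom Z' W') (g' : @hom L Y' Z') :
    mor v' ** mor (fold Z') ** lsum Z' g' =~
    mor (fold W') ** lsum W' (mor v' ** g') ** rsum Y' (mor v').
  rewrite lsum_comp rsum_mor -(compA (mor (fold _))) -(compA (lsum _ _)) -sumC.
  rewrite !compA lsum_mor -!mor_comp.
  apply: comp_heq => //; apply: mor_proper.
  apply: (cop_uniq (c := c)).
    rewrite -!(compA _ _ i1) sumr_in1 (compA _ i1) -(compA _ _ i1) suml_in1.
    by rewrite /fold !cop_in1 compm1 comp1m.
  rewrite -!(compA _ _ i2) sumr_in2 -(compA _ _ i2) suml_in2.
  by rewrite (compA _ i2) /fold !cop_in2 compm1 comp1m.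
elim: v Y g => {Z W} [Z W v | Z W s Ns | Z W U v2 IH2 v1 IH1] Y g.
- exact: mor_case.
- set t := loc_inv Ns : @hom L W Z.
  have tK : t ** mor s =~ idm (Z : L) by apply: loc_invK.
  have Kt : mor s ** t =~ idm (W : L) by apply: loc_Kinv.
  have M := mor_case _ _ _ s (t ** g).
  rewrite (compA (mor s) t) Kt comp1m in M.
  rewrite -(compm1 (t ** _ ** _)) -rsum_id -Kt rsum_comp compA.
  by rewrite -(compA t) -(compA t) -M !compA tK comp1m.
- set w1 : @hom L Z W := v1 in IH1 *; set w2 : @hom L W U := v2 in IH2 *.
  rewrite -[loc_comp w2 w1]/(w2 ** w1).
  rewrite -(compA w2) -(compA w2) IH1 rsum_comp compA compA IH2.
  by rewrite (compA w2) !compA.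
Qed.

(** Every [w] is recovered from its restrictions by folding: [fold_natural] with [v = w] and
    [g = i2] reduces this to the identity fold (i1 (+) i2) = id, which already holds in [T]. *)
Lemma verdier_cop_uniq (X Y : T) (Z : L) (u v : @hom L (X (+) Y) Z) :
  u ** mor i1 =~ v ** mor i1 -> u ** mor i2 =~ v ** mor i2 -> u =~ v.
Proof.
pose S := X (+) Y.
have E (w : @hom L S Z) :
    w =~ mor (fold Z) ** lsum Z (w ** mor i2) ** rsum Y (w ** mor i1).
  rewrite rsum_comp compA -fold_natural lsum_mor rsum_mor.
  rewrite -!compA -!mor_comp -[X in X =~ _]compm1 -mor_id.
  apply: comp_heq => //; apply: mor_proper; apply: (cop_uniq (c := c)).
    rewrite (compA (fold _)) -!(compA _ (sumr c _ _)) sumr_in1 (compA _ i1 i1).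
    by rewrite -(compA _ (suml _ _)) suml_in1 /fold cop_in1.
  rewrite (compA (fold _)) -!(compA _ (sumr c _ _)) sumr_in2
    -(compA _ (suml _ _)) suml_in2.
  by rewrite compA /fold cop_in2.
by move=> E1 E2; rewrite (E u) (E v) E1 E2.
Qed.

Definition verdier_cop (X Y Z : L) (f : hom X Z) (g : hom Y Z) :
    @hom L (X (+) Y) Z :=
  mor (fold Z) ** rsum Z f ** lsum X g.

Lemma verdier_cop_in1 (X Y Z : L) (f : hom X Z) (g : hom Y Z) :
  verdier_cop f g ** mor i1 =~ f.
Proof.
rewrite /verdier_cop -compA lsum_in1 -compA rsum_in1 compA -mor_comp.
by rewrite /fold cop_in1 mor_id comp1m.
Qed.

Lemma verdier_cop_in2 (X Y Z : L) (f : hom X Z) (g : hom Y Z) :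
  verdier_cop f g ** mor i2 =~ g.
Proof.
rewrite /verdier_cop -compA lsum_in2 compA -(compA _ _ (mor i2)) rsum_in2.
by rewrite -mor_comp /fold cop_in2 mor_id comp1m.
Qed.

(** The initial map into the target of [s] factors through [s], so a formal inverse of [s] cancels;
    hence every word carries initial maps to initial maps. *)
Lemma verdier_init_uniq (X : L) (f g : @hom L (zero c) X) : f =~ g.
Proof.
have E (Y Z : L) (h : hom Y Z) : h ** mor (init c Y) =~ mor (init c Z).
  elim: h => {Y Z} [Y Z h | Y Z s Ns | Y Z U h2 IH2 h1 IH1].
  - by rewrite -[loc_mor N h]/(mor h) -mor_comp; apply/mor_proper/init_uniq.
  - rewrite -(_ : mor (s ** init c Y) =~ mor (init c Z)); last first.
      exact/mor_proper/init_uniq.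
    rewrite mor_comp compA.
    have I : (loc_inv Ns : @hom L Z Y) ** mor s =~ idm (Y : L).
      exact: loc_invK.
    by rewrite I comp1m.
  - by rewrite -[loc_comp h2 h1]/(comp (s := L) h2 h1) -compA IH1 IH2.
rewrite -(compm1 f) -(compm1 g) -!mor_id.
have I : idm (zero c) =~ init c (zero c) by apply: init_uniq.
by rewrite I !E.
Qed.

Definition verdier_coprods : coprods L :=
  @Coprods L (zero c) (fun X => mor (init c X)) verdier_init_uniq
    (sum c) (fun X Y => mor (in1 c X Y)) (fun X Y => mor (in2 c X Y))
    verdier_cop verdier_cop_in1 verdier_cop_in2 verdier_cop_uniq.

Lemma verdier_sum_exact : sum_exact verdier_coprods.
Proof.
move=> X Y Z f g h.
move=> [X1 [Y1 [Z1 [f1 [g1 [h1 [D [a [b [d [[aI bI dI] [E _ _]]]]]]]]]]]] W.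
have [g2 [h2 /mor_dist D2]] := sum_dist D W.
have rsum_iso (P Q : L) (k : hom P Q) : is_iso k -> is_iso (rsum W k).
  by case=> k' [kK Kk]; exists (rsum W k'); rewrite -!rsum_comp kK Kk !rsum_id.
apply: (dist_conj (dist_iso (verdier_ok Tok N)) (D2 N) (rsum_iso _ _ _ aI)
          (rsum_iso _ _ _ bI) dI).
rewrite /sumr /=; apply: verdier_cop_uniq.
  rewrite -[X in X =~ _]compA verdier_cop_in1 compA rsum_in1.
  rewrite -(compA _ b) E -(compA _ (rsum W a)) rsum_in1 !compA.
  by rewrite -!mor_comp cop_in1.
rewrite -[X in X =~ _]compA verdier_cop_in2 rsum_in2 -compA rsum_in2.
by rewrite -mor_comp cop_in2.
Qed.

End LocalizationCoproducts.

(** * Homological functors, closures and killing exponents *)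

(* A functor to graded pointed sets with an endomorphism [act];
   elements are compared by [eqv], again to avoid quotients.  Additivity is
   never needed. *)
Record hfun (T : triCat) := Hfun {
  el : T -> int -> Type;
  eqv : forall X i, el X i -> el X i -> Prop;
  eqv_refl : forall X i (x : el X i), eqv x x;
  eqv_sym : forall X i (x y : el X i), eqv x y -> eqv y x;
  eqv_trans : forall X i (x y z : el X i), eqv x y -> eqv y z -> eqv x z;
  pt : forall X i, el X i;
  act : forall X i, el X i -> el X i;
  act_eqv : forall X i (x y : el X i), eqv x y -> eqv (act x) (act y);
  act_pt : forall X i, eqv (act (pt X i)) (pt X i);
  fmap : forall X Y, hom X Y -> forall i, el X i -> el Y i;
  fmap_eqv : forall X Y (f : hom X Y) i (x y : el X i),
    eqv x y -> eqv (fmap f x) (fmap f y);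
  fmap_heq : forall X Y (f g : hom X Y), heq f g ->
    forall i (x : el X i), eqv (fmap f x) (fmap g x);
  fmap_id : forall X i (x : el X i), eqv (fmap (idm X) x) x;
  fmap_comp : forall X Y Z (g : hom Y Z) (f : hom X Y) i (x : el X i),
    eqv (fmap (comp g f) x) (fmap g (fmap f x));
  fmap_pt : forall X Y (f : hom X Y) i, eqv (fmap f (pt X i)) (pt Y i);
  fmap_act : forall X Y (f : hom X Y) i (x : el X i),
    eqv (fmap f (act x)) (act (fmap f x))
}.

Arguments eqv {T} _ {X i} _ _.
Arguments pt {T} _ X i.
Arguments act {T} _ {X i} _.
Arguments fmap {T} _ {X Y} _ {i} _.

#[export] Instance eqv_equiv (T : triCat) (F : hfun T) (X : T) (i : int) :
  Equivalence (@eqv T F X i).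
Proof. split; [exact: eqv_refl | exact: eqv_sym | exact: eqv_trans]. Qed.

#[export] Instance fmap_proper (T : triCat) (F : hfun T) (X Y : T)
    (f : hom X Y) (i : int) :
  Proper (@eqv T F X i ==> @eqv T F Y i) (@fmap T F X Y f i).
Proof. by move=> x y; apply: fmap_eqv. Qed.

#[export] Instance act_proper (T : triCat) (F : hfun T) (X : T) (i : int) :
  Proper (@eqv T F X i ==> @eqv T F X i) (@act T F X i).
Proof. by move=> x y; apply: act_eqv. Qed.

#[export] Hint Extern 0 (eqv _ _ _) => reflexivity : core.

Definition vanishes (T : triCat) (F : hfun T) (X : T) : Prop :=
  forall i (x : el F X i), eqv F x (pt F X i).

Section HfunIso.
Variables (T : triCat) (F : hfun T).

Lemma fmap_isoK (X Y : T) (f : hom X Y) (g : hom Y X) (i : int)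
    (x : el F X i) : g ** f =~ idm X -> eqv F (fmap F g (fmap F f x)) x.
Proof.
by move=> gf; rewrite -fmap_comp (fmap_heq gf) fmap_id.
Qed.

Definition bijective_on (X Y : T) (f : hom X Y) : Prop :=
  (forall i (y : el F Y i), exists x, eqv F (fmap F f x) y) /\
  (forall i (x x' : el F X i),
     eqv F (fmap F f x) (fmap F f x') -> eqv F x x').

Lemma vanishes_iso (X Y : T) (f : hom X Y) :
  is_iso f -> vanishes F X -> vanishes F Y.
Proof.
case=> g [gf fg] FX i y; rewrite -(fmap_isoK y fg) (fmap_eqv f (FX i _)).
exact: fmap_pt.
Qed.

Lemma bijective_conj (X Y X' Y' : T) (f : hom X Y) (f' : hom X' Y')
    (a : hom X X') (b : hom Y Y') :
  is_iso a -> is_iso b -> b ** f =~ f' ** a ->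
  bijective_on f' -> bijective_on f.
Proof.
move=> [a' [aK Ka]] [b' [bK Kb]] E [f's f'i]; split=> i.
  move=> y; have [x' x'P] := f's i (fmap F b y).
  exists (fmap F a' x'); rewrite -(fmap_isoK (fmap F f _) bK) -(fmap_isoK y bK).
  rewrite -x'P -(fmap_comp b f) (fmap_heq E) fmap_comp.
  by rewrite (fmap_isoK x' Ka).
move=> x x' ff; rewrite -(fmap_isoK x aK) -(fmap_isoK x' aK).
apply: fmap_eqv; apply: f'i; rewrite -!fmap_comp -!(fmap_heq E).
by rewrite !fmap_comp ff.
Qed.

Definition exact_at (X Y Z : T) (f : hom X Y) (g : hom Y Z) : Prop :=
  forall i (y : el F Y i), eqv F (fmap F g y) (pt F Z i) ->
  exists x : el F X i, eqv F (fmap F f x) y.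

Lemma exact_conj (X Y Z X' Y' Z' : T) (f : hom X Y) (g : hom Y Z)
    (f' : hom X' Y') (g' : hom Y' Z') (a : hom X X') (b : hom Y Y')
    (c : hom Z Z') :
  is_iso a -> is_iso b -> b ** f =~ f' ** a -> c ** g =~ g' ** b ->
  exact_at f' g' -> exact_at f g.
Proof.
move=> [a' [aK Ka]] [b' [bK Kb]] E E' f'g' i y gy.
have [|x' x'P] := f'g' i (fmap F b y).
  by rewrite -fmap_comp -(fmap_heq E') fmap_comp gy fmap_pt.
exists (fmap F a' x'); rewrite -(fmap_isoK (fmap F f _) bK) -(fmap_isoK y bK).
rewrite -x'P -(fmap_comp b f) (fmap_heq E) fmap_comp.
by rewrite (fmap_isoK x' Ka).
Qed.

(** On pointed sets, exactness does not yield injectivity, so bijectivity on maps whose cone is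
    annihilated is recorded separately; it is what lets formal inverses act. *)
Definition exact_hfun : Prop :=
  forall (X Y Z : T) (f : hom X Y) (g : hom Y Z) (h : hom Z (sh X)),
  dist f g h -> exact_at f g /\ (vanishes F Z -> bijective_on f).

Lemma exact_tri_iso (X Y Z X' Y' Z' : T)
    (f : hom X Y) (g : hom Y Z) (h : hom Z (sh X))
    (f' : hom X' Y') (g' : hom Y' Z') (h' : hom Z' (sh X')) :
  tri_iso f g h f' g' h' ->
  exact_at f' g' /\ (vanishes F Z' -> bijective_on f') ->
  exact_at f g /\ (vanishes F Z -> bijective_on f).
Proof.
move=> [a [b [c [[aI bI cI] [E E' _]]]]] [f'g' f'_bij].
split; first exact: exact_conj aI bI E E' f'g'.
by move=> /(vanishes_iso cI) /f'_bij; apply: bijective_conj aI bI E.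
Qed.

End HfunIso.

(** * Extension of a homological functor to a localization *)

Section LocalizationHfun.
Variables (T : triCat) (F : hfun T) (N : T -> Prop).
Hypothesis Tok : tri_ok T.
Hypothesis N_sh : forall X, N X -> N (sh X).
Hypothesis Fex : exact_hfun F.
Hypothesis FN : forall X, N X -> vanishes F X.

Local Notation L := (verdier N).

Lemma cone_in_bij (X Y : T) (s : hom X Y) : cone_in N s -> bijective_on F s.
Proof.
move=> /(cone_inE Tok N_sh) [Z [g [h [D NZ]]]].
exact: (Fex D).2 (FN NZ).
Qed.

Definition inv_map (X Y : T) (s : hom X Y) (Ns : cone_in N s) (i : int)
  (y : el F Y i) : el F X i := sval (cid ((cone_in_bij Ns).1 i y)).

Lemma inv_mapK (X Y : T) (s : hom X Y) (Ns : cone_in N s) (i : int)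
  (y : el F Y i) : eqv F (fmap F s (inv_map Ns y)) y.
Proof. exact: (svalP (cid ((cone_in_bij Ns).1 i y))). Qed.

Lemma inv_mapP (X Y : T) (s : hom X Y) (Ns : cone_in N s) (i : int)
  (y : el F Y i) (x : el F X i) :
  eqv F (fmap F s x) y -> eqv F (inv_map Ns y) x.
Proof. by move=> sx; apply: (cone_in_bij Ns).2; rewrite sx inv_mapK. Qed.

Fixpoint lmap (X Y : T) (f : loc_hom N X Y) (i : int) :
    el F X i -> el F Y i :=
  match f with
  | loc_mor _ _ f => fmap F f (i := i)
  | loc_inv _ _ _ Ns => inv_map Ns (i := i)
  | loc_comp _ _ _ g f => fun x => lmap g (lmap f x)
  end.

Lemma lmap_eqv (X Y : T) (f : loc_hom N X Y) i (x y : el F X i) :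
  eqv F x y -> eqv F (lmap f x) (lmap f y).
Proof.
elim: f i x y => {X Y} /= [X Y f | X Y s Ns | X Y Z g IHg f IHf] i x y xy.
- by rewrite xy.
- by apply: inv_mapP; rewrite xy inv_mapK.
- exact/IHg/IHf.
Qed.

Lemma lmap_heq (X Y : T) (f g : loc_hom N X Y) : loc_heq f g ->
  forall i (x : el F X i), eqv F (lmap f x) (lmap g x).
Proof.
elim=> {X Y f g} /=.
- by [].
- by move=> X Y f g _ IH i x; symmetry.
- by move=> X Y f g h _ IH1 _ IH2 i x; rewrite IH1 IH2.
- by move=> X Y Z g g' f f' _ IHg _ IHf i x; rewrite IHg; apply/lmap_eqv/IHf.
- by [].
- by move=> X Y f i x; rewrite fmap_id.
- by move=> X Y f i x; apply: lmap_eqv; rewrite fmap_id.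
- by move=> X Y f g fg i x; apply: fmap_heq.
- by move=> X Y Z g f i x; apply: fmap_comp.
- by move=> X Y s Ns i x; rewrite fmap_id; apply: inv_mapP.
- by move=> X Y s Ns i x; rewrite fmap_id inv_mapK.
Qed.

Lemma lmap_pt (X Y : L) (f : hom X Y) i :
  eqv F (lmap f (pt F X i)) (pt F Y i).
Proof.
elim: f => {X Y} /= [X Y f | X Y s Ns | X Y Z g IHg f IHf].
- exact: fmap_pt.
- by apply: inv_mapP; rewrite fmap_pt.
- by rewrite -IHg; apply: lmap_eqv.
Qed.

Lemma lmap_act (X Y : L) (f : hom X Y) i (x : el F X i) :
  eqv F (lmap f (act F x)) (act F (lmap f x)).
Proof.
elim: f i x => {X Y} /= [X Y f | X Y s Ns | X Y Z g IHg f IHf] i x.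
- exact: fmap_act.
- by apply: inv_mapP; rewrite fmap_act inv_mapK.
- by rewrite -IHg; apply: lmap_eqv.
Qed.

Definition verdier_hfun : hfun L :=
  @Hfun L (el F) (@eqv T F) (@eqv_refl T F) (@eqv_sym T F) (@eqv_trans T F)
    (pt F) (@act T F) (@act_eqv T F) (@act_pt T F) lmap lmap_eqv
    lmap_heq (@fmap_id T F) (fun _ _ _ _ _ _ _ => eqv_refl _) lmap_pt
    lmap_act.

Lemma verdier_hfun_exact : exact_hfun verdier_hfun.
Proof.
move=> X Y Z f g h [X1 [Y1 [Z1 [f1 [g1 [h1 [D I]]]]]]].
apply: (@exact_tri_iso L verdier_hfun _ _ _ _ _ _ _ _ _ _ _ _ I).
exact: Fex D.
Qed.

End LocalizationHfun.

(** * Finite coproducts and the closure operation *)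

Section Closure.
Variable T : triCat.
Implicit Types (I J : T -> Prop) (X Y Z : T).

Lemma clo_min I J : (forall X, I X -> clo J X) -> forall X, clo I X -> clo J X.
Proof.
move=> IJ X; elim=> {X} [X /IJ // | X Y XY _ IH | X _ IH | X _ IH
  | m X Z inj injP _ IH | m X Z inj injP _ IH a].
- exact: clo_iso XY IH.
- exact: clo_sh.
- exact: clo_unsh.
- exact: clo_coprod injP IH.
- exact: clo_summand injP IH a.
Qed.

Lemma gen_clo I n X : clo (gen I n) X -> gen I n X.
Proof. by case: n => [|n]; apply: clo_min. Qed.

Variable c : coprods T.

Definition pair_inj X Y (a : 'I_2) :
    hom (if a : nat is 0 then X else Y) (sum c X Y) :=
  match a : nat as k return hom (if k is 0 then X else Y) (sum c X Y) with
  | 0 => in1 c X Y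
  | k.+1 => in2 c X Y
  end.

Lemma pair_coproduct X Y : is_coproduct (@pair_inj X Y).
Proof.
move=> W f; exists (cop c (f ord0) (f ord_max)).
  case=> [[|[|//]] lt].
    by rewrite (bool_irrelevance lt (ltn0Sn 1)); apply: cop_in1.
  by rewrite (bool_irrelevance lt (ltnSn 1)); apply: cop_in2.
move=> v vE; apply: (cop_uniq (c := c)).
  by rewrite cop_in1; apply: (vE ord0).
by rewrite cop_in2; apply: (vE ord_max).
Qed.

Lemma clo_sum I X Y : clo I X -> clo I Y -> clo I (sum c X Y).
Proof.
move=> IX IY; apply: clo_coprod (@pair_coproduct X Y) _.
by case=> [[|[]]].
Qed.

Lemma clo_sum1 I X Y : clo I (sum c X Y) -> clo I X.
Proof. by move=> IXY; apply: (clo_summand (@pair_coproduct X Y) IXY ord0). Qed.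

Lemma clo_sum2 I X Y : clo I (sum c X Y) -> clo I Y.
Proof. by move=> IXY; apply:
  (clo_summand (@pair_coproduct X Y) IXY ord_max). Qed.

Lemma clo_zero I : clo I (zero c).
Proof.
apply: (@clo_coprod _ _ 0 (fun=> zero c) _ (fun=> idm _)) => [W f|[]//].
exists (init c W) => [[]//|v _]; exact: init_uniq.
Qed.

Definition ord_case m (P : 'I_m.+1 -> Type) (P0 : P ord0)
    (PS : forall j : 'I_m, P (lift ord0 j)) (a : 'I_m.+1) : P a :=
  match unliftP ord0 a with
  | UnliftSome j aE => eq_rect_r P (PS j) aE
  | UnliftNone aE => eq_rect_r P P0 aE
  end.

Lemma ord_case0 m (P : 'I_m.+1 -> Type) P0 PS :
  @ord_case m P P0 PS ord0 = P0.
Proof.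
rewrite /ord_case; case: unliftP => [j E|E]; first by case/eqP:
  (neq_lift ord0 j).
by rewrite (eq_irrelevance E (erefl _)).
Qed.

Lemma ord_caseS m (P : 'I_m.+1 -> Type) P0 PS j :
  @ord_case m P P0 PS (lift ord0 j) = PS j.
Proof.
rewrite /ord_case; case: unliftP => [j' E|E].
  have jj := lift_inj E; case: _ / jj in E *.
  by rewrite (eq_irrelevance E (erefl _)).
by case/eqP: (neq_lift ord0 j).
Qed.

(** Carrying [Q] through the induction gives the existence of a coproduct and the behaviour of [Q]
    on it at once; uniqueness then extends the latter to any coproduct diagram. *)
Lemma coproduct_exists (Q : T -> Prop) m (X : 'I_m -> T) :
  Q (zero c) -> (forall Y Z, Q (sum c Y Z) <-> Q Y /\ Q Z) ->
  exists (Z : T) (inj : forall a, hom (X a) Z),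
    is_coproduct inj /\ (Q Z <-> forall a, Q (X a)).
Proof.
move=> Q0 QS; elim: m X => [|m IHm] X.
  exists (zero c), (fun a : 'I_0 => match a with Ordinal _ lt =>
    False_rect _ (notF lt) end); split=> [W f|].
    by exists (init c W) => [[]//|v _]; exact: init_uniq.
  by split=> // _ [].
have [Z [inj [injP QZ]]] := IHm (fun a => X (lift ord0 a)).
exists (sum c (X ord0) Z), (ord_case (in1 c _ _)
  (fun j => in2 c (X ord0) Z ** inj j)); split; last first.
  rewrite QS QZ; split=> [[Q1 Q2] a | Qa]; last by split.
  by case: (unliftP ord0 a) => [j|] ->.
move=> W f; have [u uE u_uniq] := injP W (fun a => f (lift ord0 a)).
exists (cop c (f ord0) u) => [a | v vE].
  case: (unliftP ord0 a) => [j|] ->; rewrite ?ord_case0 ?ord_caseS.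
    by rewrite compA cop_in2.
  exact: cop_in1.
apply: (cop_uniq (c := c)); rewrite ?cop_in1 ?cop_in2.
  by have := vE ord0; rewrite ord_case0.
by apply: u_uniq => a; have := vE (lift ord0 a); rewrite ord_caseS compA.
Qed.

Lemma coproduct_iso m (X : 'I_m -> T) Y Z (i : forall a, hom (X a) Y)
    (j : forall a, hom (X a) Z) :
  is_coproduct i -> is_coproduct j -> isomorphic Y Z.
Proof.
move=> iP jP; have [u uE _] := iP Z j; have [v vE _] := jP Y i.
exists u, v; split.
  have [w _ wU] := iP Y i; rewrite (wU (idm Y)) => [|a]; last by rewrite comp1m.
  by apply: wU => a; rewrite -compA uE vE.
have [w _ wU] := jP Z j; rewrite (wU (idm Z)) => [|a]; last by rewrite comp1m.
by apply: wU => a; rewrite -compA vE uE.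
Qed.

Lemma coproduct_closed (Q : T -> Prop) m (X : 'I_m -> T) Z
    (inj : forall a, hom (X a) Z) :
  (forall Y Z, isomorphic Y Z -> Q Y -> Q Z) ->
  Q (zero c) -> (forall Y Z, Q (sum c Y Z) <-> Q Y /\ Q Z) ->
  is_coproduct inj -> Q Z <-> forall a, Q (X a).
Proof.
move=> Qiso Q0 QS injP; have [Z' [inj' [injP' <-]]] := coproduct_exists X Q0 QS.
by split; apply: Qiso; apply: coproduct_iso injP injP' || apply:
  coproduct_iso injP' injP.
Qed.

End Closure.

(** * Killing exponents along cones *)

Section Kill.
Variables (T : triCat) (F : hfun T) (c : coprods T).
Hypothesis Fex : exact_hfun F.

Definition kills (a : nat) (X : T) : Prop :=
  forall i (x : el F X i), eqv F (iter a (act F) x) (pt F X i).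

Lemma fmap_iter (X Y : T) (f : hom X Y) a i (x : el F X i) :
  eqv F (fmap F f (iter a (act F) x)) (iter a (act F) (fmap F f x)).
Proof. by elim: a => //= a IHa; rewrite fmap_act IHa. Qed.

Lemma iter_act_eqv a X i (x y : el F X i) :
  eqv F x y -> eqv F (iter a (act F) x) (iter a (act F) y).
Proof. by move=> xy; elim: a => //= a IHa; rewrite IHa. Qed.

Lemma kills_iso a (X Y : T) : isomorphic X Y -> kills a X -> kills a Y.
Proof.
move=> [f [g [gf fg]]] KX i y; rewrite -(iter_act_eqv a (fmap_isoK y fg)).
by rewrite -fmap_iter (fmap_eqv f (KX i _)) fmap_pt.
Qed.

(** Acting [b] times sends an element of [B] to one that dies in the third term, hence comes from
    the first, where [a] more actions kill it. *)
Lemma kills_star a b (B : T) : star (kills a) (kills b) B -> kills (a + b) B.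
Proof.
move=> [X [Y [f [g [h [D KX KY]]]]]] i y.
have [|x xP] := (Fex D).1 i (iter b (act F) y).
  by rewrite fmap_iter KY.
by rewrite iterD -(iter_act_eqv a xP) -fmap_iter (fmap_eqv f (KX i x)) fmap_pt.
Qed.

Hypothesis kills_sh : forall a X, kills a (sh X) <-> kills a X.
Hypothesis kills_zero : forall a, kills a (zero c).
Hypothesis kills_sum : forall a X Y,
  kills a (sum c X Y) <-> kills a X /\ kills a Y.

Lemma kills_clo a (I : T -> Prop) :
  (forall X, I X -> kills a X) -> forall X, clo I X -> kills a X.
Proof.
move=> IK X; elim=> {X} [X /IK // | X Y XY _ | X _ | X _ | m X Z inj P _ IH
  | m X Z inj P _ IH b].
- exact: kills_iso.
- by rewrite kills_sh.
- by rewrite kills_sh.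
- exact/(coproduct_closed (@kills_iso a) (kills_zero a) (kills_sum a) P).
- exact: (coproduct_closed (@kills_iso a) (kills_zero a) (kills_sum a) P).1.
Qed.

Lemma kills_gen a (I : T -> Prop) : (forall X, I X -> kills a X) ->
  forall t X, gen I t X -> kills (t.+1 * a) X.
Proof.
move=> IK; have KI := kills_clo IK.
elim=> [|t IHt] X; first by rewrite mul1n => /KI.
apply: kills_clo => B [X1 [X2 [f [g [h [D G1 G2]]]]]].
rewrite mulSn addnC; apply: kills_star; exists X1, X2, f, g, h.
by split=> //; [apply: IHt | apply: KI].
Qed.

End Kill.

(** * The homotopy category of complexes *)

Definition mklin (S : comNzRingType) (U V : lmodType S) (f : U -> V)
    (fL : linear f) : {linear U -> V} :=
  HB.pack f (GRing.isLinear.Build S U V _ f fL).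

Section Complexes.
Variable S : comNzRingType.
Implicit Types X Y Z W : cpx S.

Fact zero_diffK (i : int) (x : 'rV[S]_0) :
  (\0 : {linear 'rV[S]_0 -> 'rV[S]_0}) ((\0 : {linear 'rV[S]_0 -> 'rV[S]_0}) x)
  = 0.
Proof. by []. Qed.

Fact zero_fin_gen (i : int) : fin_gen ('rV[S]_0 : lmodType S).
Proof. by exists 0%N, (fun=> 0) => x; exists (fun=> 0);
  rewrite big_ord0 thinmx0. Qed.

Fact zero_bounded :
  exists b : nat, forall i : int, (b < `|i|)%N -> forall x : 'rV[S]_0, x = 0.
Proof. by exists 0%N => i _ x; rewrite thinmx0. Qed.

Definition zero_cpx : cpx S :=
  @Cpx S (fun=> 'rV[S]_0 : lmodType S) (fun=> \0) zero_diffK zero_fin_gen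
    zero_bounded.

Definition null_map X Y : cmap X Y.
Proof. by refine (@Cmap S X Y (fun i => \0) _) => i x /=;
  rewrite raddf0. Defined.

Lemma from_null X Y : (forall i (x : X i), x = 0) ->
  forall f g : cmap X Y, homotopic f g.
Proof.
move=> X0 f g; apply: cmap_eq_homotopic => i x.
by rewrite (X0 i x) !linear0.
Qed.

Section Sum.
Variables X Y : cpx S.

Definition sum_term (i : int) : lmodType S := (X i * Y i)%type.

Fact sum_diff_linear (i : int) :
  linear (fun z : sum_term i => (diff X i z.1, diff Y i z.2) :
    sum_term (i + 1)).
Proof. by move=> a z w /=; rewrite !linearP. Qed.

Definition sum_diff (i : int) := mklin (@sum_diff_linear i).

Fact sum_diffK (i : int) z : sum_diff (i + 1) (sum_diff i z) = 0.
Proof. by rewrite /= !diffK. Qed.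

Fact sum_fin_gen (i : int) : fin_gen (sum_term i).
Proof.
have [m [e eP]] := term_fin_gen X i; have [p [u uP]] := term_fin_gen Y i.
exists (m + p)%N, (fun j : 'I_(m + p) =>
  match split j with inl a => (e a, 0) | inr b => (0, u b) end).
case=> x y; have [c ->] := eP x; have [v ->] := uP y.
exists (fun j => match split j with inl a => c a | inr b => v b end).
rewrite big_split_ord /=; congr pair; rewrite !raddf_sum /=.
  rewrite [X in _ = _ + X]big1 ?addr0 => [|b _]; last first.
    by rewrite (unsplitK (inr b)) /= scaler0.
  by apply: eq_bigr => a _; rewrite (unsplitK (inl a)).
rewrite [X in _ = X + _]big1 ?add0r => [|a _]; last first.
  by rewrite (unsplitK (inl a)) /= scaler0.
by apply: eq_bigr => b _; rewrite (unsplitK (inr b)).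
Qed.

Fact sum_bounded :
  exists b : nat, forall i : int, (b < `|i|)%N -> forall z : sum_term i, z = 0.
Proof.
have [b Xb] := cpx_bounded X; have [c Yc] := cpx_bounded Y.
exists (maxn b c) => i; rewrite gtn_max => /andP[bi ci] [x y].
by rewrite (Xb i bi x) (Yc i ci y).
Qed.

Definition sum_cpx : cpx S := Cpx sum_diffK sum_fin_gen sum_bounded.

Fact in1_linear (i : int) : linear (fun x : X i => (x, 0) : sum_cpx i).
Proof. by move=> a x y; congr pair; rewrite /= scaler0 addr0. Qed.

Fact in2_linear (i : int) : linear (fun y : Y i => (0, y) : sum_cpx i).
Proof. by move=> a x y; congr pair; rewrite /= scaler0 addr0. Qed.

Definition cin1 : cmap X sum_cpx.
Proof.
refine (@Cmap S X sum_cpx (fun i => mklin (@in1_linear i)) _) => i x.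
by congr pair; rewrite /= raddf0.
Defined.

Definition cin2 : cmap Y sum_cpx.
Proof.
refine (@Cmap S Y sum_cpx (fun i => mklin (@in2_linear i)) _) => i x.
by congr pair; rewrite /= raddf0.
Defined.

Fact ccop_linear Z (f : cmap X Z) (g : cmap Y Z) (i : int) :
  linear (fun z : sum_cpx i => f i z.1 + g i z.2).
Proof. by move=> a z w /=; rewrite !linearP scalerDr addrACA. Qed.

Definition ccop Z (f : cmap X Z) (g : cmap Y Z) : cmap sum_cpx Z.
Proof.
refine (@Cmap S sum_cpx Z (fun i => mklin (ccop_linear f g (i := i))) _) => i x.
by rewrite /= !cmapE linearD.
Defined.

Lemma ccop_uniq Z (u v : cmap sum_cpx Z) :
  homotopic (cmap_comp u cin1) (cmap_comp v cin1) ->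
  homotopic (cmap_comp u cin2) (cmap_comp v cin2) -> homotopic u v.
Proof.
move=> [h hE] [k kE].
have hkL (i : int) : linear (fun z : sum_cpx (i + 1) => h i z.1 + k i z.2).
  by move=> a z w /=; rewrite !linearP scalerDr addrACA.
exists (fun i => mklin (hkL i)) => i [x y] /=.
have -> : (x, y) = (x, 0) + (0, y) :> sum_cpx (i + 1).
  by congr pair; rewrite ?addr0 ?add0r.
rewrite (linearD (u _)) (linearD (v _)) opprD addrACA.
have /= -> := hE i x; have /= -> := kE i y.
by rewrite addrACA -linearD.
Qed.

End Sum.

Lemma cone_dist_closed : iso_closed (Kb S).
Proof.
move=> X Y Z X' Y' Z' f g h f' g' h' I [A [B [u I']]].
by exists A, B, u; apply: (tri_iso_trans (C := homotopy_cat S)) I I'.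
Qed.

Lemma cone_dist_std X Y (u : cmap X Y) :
  @dist (Kb S) X Y (cone u) u (cone_incl u) (cone_proj u).
Proof. by exists X, Y, u; apply: tri_iso_refl. Qed.

Section ShiftCone.
Variables (X Y : cpx S) (u : cmap X Y).

Fact shift_cone_linear (i : int) :
  linear (fun z : shift (cone u) i => (z.1, - z.2) : cone (cmap_shift u) i).
Proof. by move=> a z w; congr pair; rewrite /= opprD scalerN. Qed.

(** The sign on the second component compensates for [shift] negating the whole differential of the
    cone, including its component [u]. *)
Definition shift_cone : cmap (shift (cone u)) (cone (cmap_shift u)).
Proof.
refine (@Cmap S _ _ (fun i => mklin (@shift_cone_linear i)) _) => i [x y].
by congr pair; rewrite /= ?opprK // linearN opprK.
Defined.

Fact cone_shift_linear (i : int) :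
  linear (fun z : cone (cmap_shift u) i => (z.1, - z.2) : shift (cone u) i).
Proof. by move=> a z w; congr pair; rewrite /= opprD scalerN. Qed.

Definition cone_shift : cmap (cone (cmap_shift u)) (shift (cone u)).
Proof.
refine (@Cmap S _ _ (fun i => mklin (@cone_shift_linear i)) _) => i [x y].
by congr pair; rewrite /= ?opprK // linearN opprD opprK.
Defined.

Lemma shift_cone_iso : @is_iso (homotopy_cat S) _ _ shift_cone.
Proof.
by exists cone_shift; split; apply: cmap_eq_homotopic => i [x y];
  rewrite /= opprK.
Qed.

End ShiftCone.

Lemma Kb_ok : tri_ok (Kb S).
Proof.
split; first exact: cone_dist_closed.
move=> X Y Z f g h [A [B [u [a [b [c [[aI bI cI] [E _ _]]]]]]]].
apply: (dist_conj cone_dist_closed (cone_dist_std (cmap_shift u))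
  (is_iso_shm aI) (is_iso_shm bI)
  (is_iso_comp (C := homotopy_cat S) (shift_cone_iso u) (is_iso_shm cI))).
by rewrite -!shm_comp E.
Qed.

Definition Kb_coprods : coprods (Kb S).
Proof.
refine (@Coprods (Kb S) zero_cpx (null_map zero_cpx) _ sum_cpx cin1 cin2 ccop
  _ _ ccop_uniq) => *.
- by apply: from_null => i x; rewrite thinmx0.
- by apply: cmap_eq_homotopic => i x /=; rewrite linear0 addr0.
- by apply: cmap_eq_homotopic => i x /=; rewrite linear0 add0r.
Defined.

Section SumCone.
Variables (X Y W : cpx S) (u : cmap X Y).
Local Notation v := (@sumr (Kb S) Kb_coprods W X Y u : cmap _ _).

Fact sum_cone_in_linear (i : int) :
  linear (fun z : cone u i => ((z.1, 0), (z.2, 0)) : cone v i).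
Proof.
by move=> a z w; congr (pair (pair _ _) (pair _ _)); rewrite /= scaler0 addr0.
Qed.

Definition sum_cone_in : cmap (cone u) (cone v).
Proof.
refine (@Cmap S _ _ (fun i => mklin (@sum_cone_in_linear i)) _) => i [x y].
by congr (pair (pair _ _) (pair _ _));
  rewrite /= ?raddf0 ?oppr0 ?addr0 ?add0r.
Defined.

Fact sum_cone_out_linear (i : int) :
  linear (fun z : cone v i => (z.1.1, z.2.1) : cone u i).
Proof. by []. Qed.

Definition sum_cone_out : cmap (cone v) (cone u).
Proof.
refine (@Cmap S _ _ (fun i => mklin (@sum_cone_out_linear i)) _).
by move=> i [[x w] [y w']]; congr pair; rewrite /= addr0.
Defined.

Fact sum_cone_htpy_linear (i : int) :
  linear (fun z : cone v (i + 1) => ((0, - z.2.2), (0, 0)) : cone v i).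
Proof.
move=> a z w; congr (pair (pair _ _) (pair _ _)); rewrite /= ?scaler0 ?addr0 //.
by rewrite opprD scalerN.
Qed.

(** The cone of [u (+) id_W] is that of [u] plus the cone of the identity of [W], which the homotopy
    contracts. *)
Lemma sum_cone_iso : @is_iso (homotopy_cat S) _ _ sum_cone_in.
Proof.
exists sum_cone_out; split; first by apply: cmap_eq_homotopic => i [x y].
exists (fun i => mklin (@sum_cone_htpy_linear i)) => i [[x w] [y w']].
congr (pair (pair _ _) (pair _ _)); rewrite /= ?raddf0 ?oppr0 ?addr0 ?add0r
  ?subrr //.
  by rewrite linearN opprK opprD addrCA subrr addr0.
Qed.

End SumCone.

Lemma Kb_sum_exact : sum_exact Kb_coprods.
Proof.
move=> X Y Z f g h [A [B [u [a [b [c [[aI bI cI] [E _ _]]]]]]]] W.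
apply: (dist_conj cone_dist_closed
  (cone_dist_std (sumr Kb_coprods W (u : @hom (Kb S) A B) : cmap _ _))
  (sumr_iso _ W aI) (sumr_iso _ W bI)
  (is_iso_comp (C := homotopy_cat S) (sum_cone_iso W u) cI)).
by rewrite -!sumr_comp; apply: sumr_heq.
Qed.

Lemma acyclic_shift X : acyclic X -> acyclic (shift X).
Proof.
move=> Xac i x /= /eqP; rewrite oppr_eq0 => /eqP /Xac [y yx].
by exists (- y); rewrite linearN /= opprK.
Qed.

Lemma perfect_shift X : perfect X -> perfect (shift X).
Proof. by move=> XP i; apply: XP. Qed.

Lemma Db_ok : tri_ok (Db S).
Proof. exact: verdier_ok Kb_ok _. Qed.

Lemma Dsg_ok : tri_ok (Dsg S).
Proof. exact: verdier_ok Db_ok _. Qed.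

Definition Db_coprods : coprods (Db S) :=
  verdier_coprods Kb_sum_exact Kb_ok acyclic_shift.

Lemma Db_sum_exact : sum_exact Db_coprods.
Proof. exact: verdier_sum_exact. Qed.

Definition Dsg_coprods : coprods (Dsg S) :=
  verdier_coprods Db_sum_exact Db_ok perfect_shift.

End Complexes.

(** * Subcomplexes and isomorphisms in the singularity category *)

(** Membership is a proposition, so that submodules can be cut out by any condition; [smem_pred]
    makes it boolean classically, as the subtype structures require. *)
Record submod (S : nzRingType) (M : lmodType S) := Submod {
  smem :> M -> Prop;
  smem0 : smem 0;
  smemP : forall a x y, smem x -> smem y -> smem (a *: x + y)
}.

Section Submodule.
Variables (S : nzRingType) (M : lmodType S) (U : submod M).

Definition smem_pred : {pred M} := fun x => `[< smem U x >].

Fact smem_closed : submod_closed smem_pred.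
Proof.
split; first exact/asboolP/smem0.
by move=> a x y /asboolP Ux /asboolP Uy; apply/asboolP/smemP.
Qed.

HB.instance Definition _ :=
  GRing.isSubmodClosed.Build S M smem_pred smem_closed.

Record submod_type :=
  SubmodType { sm_val :> M; sm_valP : sm_val \in smem_pred }.

HB.instance Definition _ := [isSub for sm_val].
HB.instance Definition _ := [Choice of submod_type by <:].
HB.instance Definition _ := [SubChoice_isSubLmodule of submod_type by <:].

Lemma sm_mem (x : submod_type) : U (\val x).
Proof. by have /asboolP := valP x. Qed.

Definition sm_sub (x : M) (Ux : U x) : submod_type :=
  SubmodType (asboolT Ux : x \in smem_pred).

Lemma smemD x y : U x -> U y -> U (x + y).
Proof. by move=> Ux Uy; rewrite -[x]scale1r; apply: smemP. Qed.

Lemma smemZ a x : U x -> U (a *: x).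
Proof. by move=> Ux; rewrite -[_ *: x]addr0; apply: smemP => //; apply:
  smem0. Qed.

End Submodule.

Section Subcomplex.
Variables (S : comNzRingType) (X : cpx S) (U : forall i, submod (X i)).
Hypothesis U_diff : forall i x, U i x -> U (i + 1) (diff X i x).
Hypothesis U_fin_gen : forall i, fin_gen (submod_type (U i) : lmodType S).

Fact sub_diff_subproof i (x : submod_type (U i)) :
  U (i + 1) (diff X i (\val x)).
Proof. exact/U_diff/sm_mem. Qed.

Definition sub_diff_fun i (x : submod_type (U i)) : submod_type (U (i + 1)) :=
  sm_sub (sub_diff_subproof x).

Fact sub_diff_linear i : linear (@sub_diff_fun i).
Proof. by move=> a x y; apply: val_inj; rewrite /= linearP. Qed.

Definition sub_diff i := mklin (@sub_diff_linear i).

Fact sub_diffK i x : sub_diff (i + 1) (sub_diff i x) = 0.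
Proof. by apply: val_inj; rewrite /= diffK. Qed.

Fact sub_bounded : exists b : nat, forall i : int, (b < `|i|)%N ->
  forall x : submod_type (U i), x = 0.
Proof.
have [b Xb] := cpx_bounded X; exists b => i bi x.
exact/val_inj/(Xb i bi).
Qed.

Definition sub_cpx : cpx S :=
  @Cpx S (fun i => submod_type (U i)) sub_diff sub_diffK U_fin_gen sub_bounded.

Fact sub_incl_linear i : linear (fun x : sub_cpx i => \val x : X i).
Proof. by []. Qed.

Definition sub_incl : cmap sub_cpx X :=
  @Cmap S sub_cpx X (fun i => mklin (@sub_incl_linear i)) (fun i x => erefl).

Section Corestriction.
Variables (Y : cpx S) (f : cmap Y X).
Hypothesis fU : forall i y, U i (f i y).

Fact corestr_linear i : linear (fun y : Y i => sm_sub (fU y) : sub_cpx i).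
Proof. by move=> a x y; apply: val_inj; rewrite /= linearP. Qed.

Definition corestr : cmap Y sub_cpx.
Proof.
refine (@Cmap S Y sub_cpx (fun i => mklin (@corestr_linear i)) _) => i x.
by apply: val_inj; rewrite /= cmapE.
Defined.

End Corestriction.
End Subcomplex.

(** * Quasi-isomorphisms and short exact sequences *)

Section Tools.
Variable S : comNzRingType.
Implicit Types X Y Z : cpx S.

Definition to_Db X Y (f : cmap X Y) : @hom (Db S) X Y :=
  @mor (Kb S) (@acyclic S) X Y f.

Definition to_Dsg X Y (f : cmap X Y) : @hom (Dsg S) X Y :=
  @mor (Db S) (@perfect S) X Y (to_Db f).

Lemma qis_Db X Y (q : cmap X Y) : acyclic (cone q) -> is_iso (to_Db q).
Proof.
move=> qac; apply: mor_cone_in.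
exact: cone_in_dist (cone_dist_std q) qac.
Qed.

Lemma qis_iso X Y (q : cmap X Y) : acyclic (cone q) -> is_iso (to_Dsg q).
Proof. by move=> /qis_Db; apply: mor_iso. Qed.

(** The second hypothesis says that the cokernel of [q] is acyclic. *)
Lemma inj_qis X Y (q : cmap X Y) :
  (forall i x, q i x = 0 -> x = 0) ->
  (forall i (y : Y (i + 1)), (exists x, q _ x = diff Y (i + 1) y) ->
     exists w x, y = diff Y i w + q _ x) ->
  acyclic (cone q).
Proof.
move=> q_inj qP i [x y] /= E.
have qdx : q (i + 1 + 1) x = - diff Y (i + 1) y.
  by apply/eqP; rewrite -addr_eq0; apply/eqP; case: E.
have [|w [x' yE]] := qP i y; first by exists (- x);
  rewrite linearN /= qdx opprK.
exists (x', w); congr pair; last by rewrite /= yE (addrC (q _ _)).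
apply/eqP; rewrite -subr_eq0; apply/eqP; apply: q_inj.
rewrite linearB linearN /= qdx yE cmapE linearD diffK add0r.
by rewrite opprK addNr.
Qed.

(** The second hypothesis says that the kernel of [q] is acyclic. *)
Lemma surj_qis X Y (q : cmap X Y) :
  (forall i y, exists x, q i x = y) ->
  (forall i (x : X (i + 1)), q _ x = 0 -> diff X (i + 1) x = 0 ->
     exists2 w, q _ w = 0 & diff X i w = x) ->
  acyclic (cone q).
Proof.
move=> q_surj qP i [x y] /= E.
have dx : diff X (i + 1 + 1) x = 0.
  by apply/eqP; rewrite -oppr_eq0; apply/eqP; case: E.
have qx : q (i + 1 + 1) x = - diff Y (i + 1) y.
  by apply/eqP; rewrite -addr_eq0; apply/eqP; case: E.
have [x0 x0y] := q_surj (i + 1) y.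
have [||w qw wE] := qP (i + 1) (x + diff X _ x0).
- by rewrite linearD /= cmapE x0y qx addNr.
- by rewrite linearD /= diffK dx addr0.
exists (x0 - w, 0); congr pair; rewrite /= linearB /= ?qw ?subr0 ?linear0
  ?addr0 //.
by rewrite wE opprB addrK.
Qed.

(** In place of a rotation axiom, the explicit quasi-isomorphism p |-> (- f p, (p, 0)) identifies
    the perfect complex P[1] with the cone of the inclusion X -> cone f. *)
Lemma cone_incl_iso P X (f : cmap P X) :
  perfect P -> is_iso (to_Dsg (cone_incl f)).
Proof.
move=> Pp; have cL i : linear (fun p : shift P i =>
    (- f (i + 1) p, (p, 0)) : cone (cone_incl f) i).
  move=> a x y; congr (pair _ (pair _ _)); rewrite /= ?scaler0 ?addr0 //.
  by rewrite linearP opprD scalerN.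
have cE i p : mklin (cL (i + 1)) (diff (shift P) i p) =
    diff (cone (cone_incl f)) i (mklin (cL i) p).
  congr (pair _ (pair _ _)); rewrite /= ?linear0 ?addr0 ?addNr ?add0r //.
  by rewrite !linearN /= opprK cmapE opprK.
pose c := @Cmap S (shift P) (cone (cone_incl f)) (fun i => mklin (cL i)) cE.
have cI : is_iso (to_Db c).
  apply/qis_Db/inj_qis => [i p [_ //] | i [x [p x']] [p' [_ p'E pE]]].
  exists (x', (0, 0)), p; congr (pair _ (pair _ _));
    rewrite /= ?linear0 ?oppr0 ?addr0 ?add0r //.
  by apply/eqP; rewrite -subr_eq0 -opprD opprK (addrC (diff _ _ _)) -pE.
have sq : idm (cone f : Db S) ** to_Db (cone_incl f) =~
    to_Db (cone_incl f) ** idm (X : Db S) by rewrite comp1m compm1.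
have [g [h D]] := dist_conj (dist_iso (Db_ok S)) (mor_dist _ (cone_dist_std
  (cone_incl f))) (is_iso_id _) (is_iso_id _) cI sq.
by apply: mor_cone_in; apply: cone_in_dist D (perfect_shift Pp).
Qed.

Lemma bij_iso X Y (q : cmap X Y) :
  (forall i x, q i x = 0 -> x = 0) -> (forall i y, exists x, q i x = y) ->
  is_iso (to_Dsg q).
Proof.
move=> q_inj q_surj; apply/qis_iso/inj_qis => // i y _.
by have [x <-] := q_surj _ y; exists 0, x; rewrite linear0 add0r.
Qed.

Lemma to_Dsg_eq X Y (f g : cmap X Y) :
  (forall i x, f i x = g i x) -> to_Dsg f =~ to_Dsg g.
Proof.
move=> fg; apply: (@loc_mor_heq (Db S) (@perfect S)).
apply: (@loc_mor_heq (Kb S) (@acyclic S)).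
exact: cmap_eq_homotopic.
Qed.

Lemma to_Dsg_comp X Y Z (g : cmap Y Z) (f : cmap X Y) :
  to_Dsg (cmap_comp g f) =~ to_Dsg g ** to_Dsg f.
Proof.
transitivity (@mor (Db S) (@perfect S) X Z (to_Db g ** to_Db f)).
  apply: (@loc_mor_heq (Db S) (@perfect S)).
  exact: (mor_comp (T := Kb S) (@acyclic S) g f).
exact: (mor_comp (T := Db S) (@perfect S) (to_Db g) (to_Db f)).
Qed.

(** The map (x, y) |-> g y is a quasi-isomorphism from the cone of [f] to [Z], along which the
    standard triangle is transported. *)
Lemma ses_star (I J : Dsg S -> Prop) X Y Z (f : cmap X Y) (g : cmap Y Z) :
  (forall i x, f i x = 0 -> x = 0) -> (forall i z, exists y, g i y = z) ->
  (forall i x, g i (f i x) = 0) ->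
  (forall i y, g i y = 0 -> exists x, f i x = y) ->
  I X -> J Z -> star I J Y.
Proof.
move=> f_inj g_surj gf fg IX JZ.
have qL i : linear (fun z : cone f i => g i z.2) by move=> a z w /=;
  rewrite linearP.
have qE i z : mklin (qL (i + 1)) (diff (cone f) i z) = diff Z i (mklin (qL i)
  z).
  by rewrite /= linearD gf add0r cmapE.
pose q := @Cmap S (cone f) Z (fun i => mklin (qL i)) qE.
have qI : is_iso (to_Dsg q).
  apply/qis_iso/surj_qis => [i z | i [x y] /= gy [_ dxy]].
    by have [y <-] := g_surj i z; exists (0, y).
  have [x0 x0y] := fg _ y gy.
  exists (x0, 0); first by rewrite /= linear0.
  congr pair; last by rewrite /= x0y linear0 addr0.
  apply/eqP; rewrite -subr_eq0; apply/eqP; apply: f_inj.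
  rewrite linearB linearN /= cmapE x0y -opprD (addrC (diff _ _ _)).
  by rewrite dxy oppr0.
have [p [qK Kq]] := qI.
exists X, Z, (to_Dsg f), (to_Dsg g),
  (@mor (Db S) (@perfect S) _ _ (to_Db (cone_proj f)) ** p); split=> //.
have D := @mor_dist (Db S) (@perfect S) _ _ _ _ _ _
  (@mor_dist (Kb S) (@acyclic S) _ _ _ _ _ _ (cone_dist_std f)).
apply: (dist_iso (Dsg_ok S)) D.
exists (idm (X : Dsg S)), (idm (Y : Dsg S)), p; split.
  by split; [exact: is_iso_id | exact: is_iso_id | exists (to_Dsg q)].
split; first by rewrite comp1m compm1.
  have E : to_Dsg g =~ to_Dsg q ** to_Dsg (cone_incl f).
    by rewrite -to_Dsg_comp; apply: to_Dsg_eq.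
  by rewrite E compA qK comp1m compm1.
by rewrite shm_id comp1m.
Qed.

End Tools.

(** * Uniserial rings and cyclic modules *)

(** The ideals are exactly the distinct (u^i) for 0 <= i <= n. Zero is covered by [chain_unit] as
    [u ^+ n * 1]. *)
Record chain_ring (A : comNzRingType) (u : A) (n : nat) : Prop := ChainRing {
  chain_nilp : u ^+ n = 0;
  chain_order : forall i, (i < n)%N -> u ^+ i != 0;
  chain_unit : forall a : A,
    exists (i : nat) (w w' : A), w * w' = 1 /\ a = u ^+ i * w
}.

Definition span_submod (A : comNzRingType) (M : lmodType A) m (e : 'I_m -> M) :
  submod M.
Proof.
refine (@Submod A M (fun x => exists c, x = \sum_(i < m) c i *: e i) _ _).
  by exists (fun=> 0); rewrite big1 // => i _; rewrite scale0r.
move=> a _ _ [c ->] [d ->]; exists (fun i => a * c i + d i).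
rewrite scaler_sumr -big_split; apply: eq_bigr => i _ /=.
by rewrite scalerDl scalerA.
Defined.

Definition meet_submod (A : comNzRingType) (M : lmodType A) (U V : submod M) :
  submod M.
Proof.
refine (@Submod A M (fun x => U x /\ V x) _ _); first by split; apply: smem0.
by move=> a x y [Ux Vx] [Uy Vy]; split; apply: smemP.
Defined.

Section ChainRing.
Variables (A : comNzRingType) (u : A) (n : nat).
Hypothesis Ach : chain_ring u n.

Lemma chain_ann i (a : A) : (i <= n)%N -> u ^+ i * a = 0 ->
  exists b, a = u ^+ (n - i) * b.
Proof.
move=> ni; have [j [w [w' [ww ->]]]] := chain_unit Ach a.
rewrite mulrA -exprD => /(congr1 ( *%R^~ w')).
rewrite -mulrA ww mulr1 mul0r => /eqP uij.
have nij : (n <= i + j)%N.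
  by rewrite leqNgt; apply: contraTN uij => /(chain_order Ach).
by exists (u ^+ (j - (n - i)) * w); rewrite mulrA -exprD; congr (u ^+ _ * _);
  lia.
Qed.

Lemma rV_ann r i (x : 'rV[A]_r) : (i <= n)%N -> u ^+ i *: x = 0 ->
  exists y, x = u ^+ (n - i) *: y.
Proof.
move=> ni ux0.
have /choice [y yP] (j : 'I_r) : exists b, x 0 j = u ^+ (n - i) * b.
  by apply: chain_ann => //; move/rowP/(_ j): ux0; rewrite !mxE.
by exists (\row_j y j); apply/rowP => j; rewrite !mxE.
Qed.

(* [P 0] ensures that the minimum exists, as 0 counts as [u ^+ n * 1]. *)
Lemma min_exponent (P : A -> Prop) : P 0 ->
  exists i w w', [/\ (i <= n)%N, w * w' = 1, P (u ^+ i * w) &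
    forall a, P a -> exists b, a = u ^+ i * b].
Proof.
move=> P0; pose Q i := `[< exists w w', w * w' = 1 /\ P (u ^+ i * w) >].
have Qn : Q n.
  by apply/asboolP; exists 1, 1; rewrite (chain_nilp Ach) mul0r mulr1.
have [i /asboolP[w [w' [ww Pi]]] i_min] := ex_minnP (ex_intro (fun i =>
  is_true (Q i)) n Qn).
exists i, w, w'; split=> //; first exact: i_min.
move=> a; have [j [v [v' [vv ->]]]] := chain_unit Ach a => Pa.
have ij : (i <= j)%N by apply: i_min; apply/asboolP; exists v, v'.
by exists (u ^+ (j - i) * v); rewrite mulrA -exprD subnKC.
Qed.

(** Induction on [m]: the coefficients of elements of [U] along the first generator form an ideal
    (u^i), which some [x0] in [U] attains up to a unit; subtracting a multiple of [x0] lands in the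
    span of the other generators. *)
Lemma sub_span_fin_gen (M : lmodType A) m (e : 'I_m -> M) (U : submod M) :
  (forall x, U x -> span_submod e x) ->
  exists r (v : 'I_r -> M), (forall j, U (v j)) /\
    forall x, U x -> span_submod v x.
Proof.
elim: m e U => [|m IHm] e U Ue.
  exists 0%N, (fun=> 0); split=> [[]//|x /Ue[c ->]].
  by exists (fun=> 0); rewrite !big_ord0.
pose e' j := e (lift ord0 j).
pose P a := exists2 x, U x & span_submod e' (x - a *: e ord0).
have [|i [w [w' [_ ww [x0 Ux0 [c0 x0E]] Pmin]]]] := @min_exponent P.
  by exists 0; [exact: smem0 | rewrite scale0r subr0; apply: smem0].
have [|r [v [Uv vP]]] := IHm e' (meet_submod U (span_submod e')).
  by move=> x [].
exists r.+1, (fun j => if unlift ord0 j is Some j' then v j' else x0).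
split=> [j|x Ux]; first by case: unlift => // j'; have [] := Uv j'.
have [c xE] := Ue x Ux.
have [|b cE] := Pmin (c ord0).
  exists x => //; exists (fun j => c (lift ord0 j)).
  by rewrite xE big_ord_recl addrAC subrr add0r.
have [|d dE] := vP (x - (b * w') *: x0).
  split; first by rewrite -scaleNr; apply/smemD/smemZ.
  have -> : x - (b * w') *: x0 = (x - c ord0 *: e ord0)
      + - (b * w') *: (x0 - (u ^+ i * w) *: e ord0).
    rewrite scaleNr scalerBr scalerA cE.
    have -> : b * w' * (u ^+ i * w) = u ^+ i * b.
      by rewrite mulrCA -mulrA (mulrC w') ww mulr1.
    by rewrite opprB addrA subrK.
  apply: smemD; last by apply: smemZ; exists c0.
  by exists (fun j => c (lift ord0 j));
    rewrite xE big_ord_recl addrAC subrr add0r.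
exists (fun j => if unlift ord0 j is Some j' then d j' else b * w').
rewrite big_ord_recl unlift_none -[LHS](subrK ((b * w') *: x0)) addrC dE.
by congr (_ + _); apply: eq_bigr => j _; rewrite liftK.
Qed.

Lemma submod_fin_gen (M : lmodType A) (U : submod M) :
  fin_gen M -> fin_gen (submod_type U : lmodType A).
Proof.
move=> [m [e eP]]; have [|r [v [Uv vP]]] := @sub_span_fin_gen M m e U.
  by move=> x _; apply: eP.
exists r, (fun j => sm_sub (Uv j)) => x; have [c xE] := vP _ (sm_mem x).
by exists c; apply: val_inj; rewrite raddf_sum.
Qed.

Definition subcx (X : cpx A) (U : forall i, submod (X i))
    (U_diff : forall i x, U i x -> U (i + 1) (diff X i x)) : cpx A :=
  sub_cpx U_diff (fun i => submod_fin_gen (U i) (term_fin_gen X i)).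

End ChainRing.

(** * Free modules placed in one degree *)

Section Free.
Variable A : comNzRingType.

Definition free_rank (c : int) (r : nat) (i : int) : nat :=
  if i == c then r else 0.

Fact free_fin_gen c r (i : int) :
  fin_gen ('rV[A]_(free_rank c r i) : lmodType A).
Proof.
exists (free_rank c r i), (fun j => delta_mx 0 j) => x.
by exists (x 0); rewrite {1}[x]row_sum_delta.
Qed.

Fact free_bounded c r : exists b : nat, forall i : int, (b < `|i|)%N ->
  forall x : 'rV[A]_(free_rank c r i), x = 0.
Proof.
exists `|c|%N => i ci; rewrite /free_rank; case: eqP => [E|_] x.
  by rewrite E ltnn in ci.
by rewrite thinmx0.
Qed.

Definition free_cpx (c : int) (r : nat) : cpx A :=
  @Cpx A (fun i => 'rV[A]_(free_rank c r i) : lmodType A) (fun i => \0)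
    (fun i x => erefl) (free_fin_gen c r) (free_bounded c r).

Lemma rV_projective r : projective ('rV[A]_r : lmodType A).
Proof.
move=> M N p g p_surj.
have /choice [m mP] (j : 'I_r) : exists x, p x = g (delta_mx 0 j).
  exact: p_surj.
have fL : linear (fun x : 'rV[A]_r => \sum_j x 0 j *: m j).
  move=> a x y; rewrite scaler_sumr -big_split; apply: eq_bigr => j _ /=.
  by rewrite !mxE scalerDl scalerA.
exists (mklin fL) => x /=; rewrite {2}[x]row_sum_delta !linear_sum.
by apply: eq_bigr => j _; rewrite !linearZ /= mP.
Qed.

Lemma free_perfect c r : perfect (free_cpx c r).
Proof. by move=> i; apply: rV_projective. Qed.

End Free.

(** * Cyclic modules, their exact sequences and their shifts *)

Section Torsion.
Variables (A : comNzRingType) (u : A) (n : nat).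
Hypothesis Ach : chain_ring u n.

Definition tors_submod (M : lmodType A) (p : nat) : submod M.
Proof.
refine (@Submod A M (fun x => u ^+ p *: x = 0) _ _); first by rewrite scaler0.
move=> a x y x0 y0.
by rewrite scalerDr scalerA mulrC -scalerA x0 y0 scaler0 addr0.
Defined.

Fact tors_diff (X : cpx A) p i x :
  tors_submod (X i) p x -> tors_submod (X (i + 1)) p (diff X i x).
Proof. by rewrite /= -linearZ => ->; rewrite linear0. Qed.

Definition tors (X : cpx A) (p : nat) : cpx A := subcx Ach (@tors_diff X p).

(* [cyc c p] is the cyclic module of length [p] (for [p <= n]), realized as
   the ideal of the elements killed by [u ^+ p] and placed in degree [c]. *)
Definition cyc (c : int) (p : nat) : cpx A := tors (free_cpx A c 1) p.

Lemma cyc_diff c p i (x : cyc c p i) : diff (cyc c p) i x = 0.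
Proof. exact: val_inj. Qed.

Lemma cyc_val c p i (x y : cyc c p i) : x = y -> \val x = \val y.
Proof. by move=> ->. Qed.

Lemma cyc_mem c p i (x : cyc c p i) : u ^+ p *: \val x = 0.
Proof. exact: (sm_mem x). Qed.

Lemma cyc_ann c p q i (x : cyc c p i) : (q <= n)%N -> u ^+ q *: \val x = 0 ->
  exists y : 'rV[A]_(free_rank c 1 i), \val x = u ^+ (n - q) *: y.
Proof. exact: rV_ann. Qed.

Fact scal_linear (X : cpx A) (a : A) (i : int) :
  linear (fun x : X i => a *: x).
Proof. by move=> b x y; rewrite scalerDr !scalerA mulrC. Qed.

Definition scal (X : cpx A) (a : A) : cmap X X.
Proof.
refine (@Cmap A X X (fun i => mklin (scal_linear a (i := i))) _) => i x.
by rewrite /= linearZ.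
Defined.

Fact cyc_mul_mem c p q b : (p <= q + b)%N -> forall i (x : cyc c p i),
  tors_submod (free_cpx A c 1 i) q (cmap_comp (scal _ (u ^+ b))
    (sub_incl (@tors_diff (free_cpx A c 1) p)
       (fun i => submod_fin_gen Ach _ (term_fin_gen _ i))) i x).
Proof.
move=> pqb i x; rewrite /= scalerA -exprD -(subnK pqb) exprD.
by rewrite -scalerA cyc_mem scaler0.
Qed.

(** Multiplication by [u ^+ b]: an inclusion for [b = 0], a surjection for [p = q + b <= n]. *)
Definition cyc_mul c p q b (pqb : (p <= q + b)%N) : cmap (cyc c p) (cyc c q) :=
  corestr (@tors_diff (free_cpx A c 1) q)
    (fun i => submod_fin_gen Ach _ (term_fin_gen _ i)) (cyc_mul_mem pqb).

Fact cpair_linear (X Y Z : cpx A) (f : cmap X Y) (g : cmap X Z) (i : int) :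
  linear (fun x : X i => (f i x, g i x) : sum_cpx Y Z i).
Proof. by move=> a x y; rewrite !linearP. Qed.

Definition cpair (X Y Z : cpx A) (f : cmap X Y) (g : cmap X Z) :
  cmap X (sum_cpx Y Z).
Proof.
refine (@Cmap A X _ (fun i => mklin (cpair_linear f g (i := i))) _) => i x.
by rewrite /= !cmapE.
Defined.

(** Inside [A], M_(r+s) is the preimage of M_r under the surjection u^s : M_(q+s) -> M_q. The
    sequence of this pullback square, with maps (inclusion, u^s) and (u^s, - inclusion), is short
    exact. *)
Lemma cyc_star (I J : Dsg A -> Prop) c q r s :
  (r <= q)%N -> (q + s <= n)%N -> I (cyc c (r + s)) -> J (cyc c q) ->
  star I J (sum_cpx (cyc c (q + s)) (cyc c r)).
Proof.
move=> rq qsn IX JZ.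
have H1 : (r + s <= q + s + 0)%N by rewrite addn0 leq_add2r.
have H3 : (r <= q + 0)%N by rewrite addn0.
pose f := cpair (cyc_mul c H1) (cyc_mul c (leqnn (r + s)%N)).
pose g := ccop (cyc_mul c (leqnn (q + s)%N))
  (cmap_comp (scal (cyc c q) (-1)) (cyc_mul c H3)).
apply: (@ses_star A I J _ _ _ f g) IX JZ.
- by move=> i x []; rewrite expr0 scale1r => x0 _; apply: val_inj.
- move=> i z; have qn : (q <= n)%N by apply: leq_trans qsn; apply: leq_addr.
  have [y zE] := cyc_ann qn (cyc_mem z).
  have yM : tors_submod (free_cpx A c 1 i) (q + s) (u ^+ (n - (q + s)) *: y).
    by rewrite /= scalerA -exprD subnKC // (chain_nilp Ach) scale0r.
  exists (sm_sub yM, 0); apply: val_inj; rewrite /= !linear0 /= ?scaler0 ?addr0.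
  by rewrite zE scalerA -exprD; congr (u ^+ _ *: _); lia.
- move=> i x; apply: val_inj.
  by rewrite /= expr0 !scale1r scaleN1r subrr.
- move=> i [y z] /cyc_val gyz; have yz : u ^+ s *: \val y = \val z.
    move: gyz; rewrite /= expr0 scale1r scaleN1r => /eqP.
    by rewrite subr_eq0 => /eqP.
  have yM : tors_submod (free_cpx A c 1 i) (r + s) (\val y).
    by rewrite /= exprD -scalerA yz cyc_mem.
  exists (sm_sub yM); congr pair; apply: val_inj; rewrite /= ?yz //.
  by rewrite expr0 scale1r.
Qed.

(** Multiplication by u^(n-p) maps [A] onto M_p with kernel M_(n-p). Its cone is thus M_(n-p)[1],
    and also M_p since [A] is perfect. *)
Lemma cyc_shift c p : (p <= n)%N ->
  isomorphic (cyc c p : Dsg A) (sh (cyc c (n - p) : Dsg A)).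
Proof.
move=> pn.
have fM i (x : free_cpx A c 1 i) :
    tors_submod (free_cpx A c 1 i) p (scal (free_cpx A c 1) (u ^+ (n - p)) i x).
  by rewrite /= scalerA -exprD subnKC // (chain_nilp Ach) scale0r.
pose f : cmap (free_cpx A c 1) (cyc c p) :=
  corestr (@tors_diff (free_cpx A c 1) p)
    (fun i => submod_fin_gen Ach _ (term_fin_gen _ i)) fM.
have qL i : linear (fun x : shift (cyc c (n - p)) i => (\val x, 0) : cone f i).
  by move=> a x y; congr pair; rewrite /= scaler0 addr0.
have qE i x : mklin (qL (i + 1)) (diff (shift (cyc c (n - p))) i x) =
    diff (cone f) i (mklin (qL i) x).
  by congr pair; apply: val_inj; rewrite /= addr0 (cyc_mem x).
pose q := @Cmap A _ _ (fun i => mklin (qL i)) qE.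
apply: isomorphic_trans (_ : isomorphic (cone f : Dsg A) _).
  by exists (to_Dsg (cone_incl f)); apply/cone_incl_iso/free_perfect.
apply: isomorphic_sym; exists (to_Dsg q); apply/qis_iso/inj_qis.
  by move=> i x [x0]; apply: val_inj.
move=> i [x z] [x' [_]]; rewrite addr0 => /esym fx0.
have [w zw] := cyc_ann pn (cyc_mem z).
exists (w, 0), (sm_sub (fx0 : tors_submod (free_cpx A c 1 _) (n - p) x)).
congr pair; first by rewrite /= oppr0 add0r.
by apply: val_inj; rewrite /= zw !addr0.
Qed.

End Torsion.

(** * Classification of the objects *)

Definition concentrated (A : comNzRingType) (X : cpx A) (a b : int) : Prop :=
  forall i, (i < a) || (b < i) -> forall x : X i, x = 0.

Lemma free_rank_ord c r i : 'I_(free_rank c r i) -> i = c.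
Proof. by rewrite /free_rank; case: eqP => // _ []. Qed.

Section FreeMap.
Variables (A : comNzRingType) (X : cpx A) (c : int) (r : nat).
Variable g : forall i, nat -> X i.
Hypothesis g_cycle : forall j, diff X c (g c j) = 0.

Fact free_map_linear i : linear (fun v : free_cpx A c r i =>
  \sum_(j < free_rank c r i) v 0 j *: g i j).
Proof.
move=> a x y; rewrite scaler_sumr -big_split; apply: eq_bigr => j _ /=.
by rewrite !mxE scalerDl scalerA.
Qed.

Definition free_map : cmap (free_cpx A c r) X.
Proof.
refine (@Cmap A (free_cpx A c r) X (fun i => mklin (@free_map_linear i)) _).
move=> i x; rewrite /= linear_sum /= !big1 // => j _.
  have ic := free_rank_ord j.
  by rewrite linearZ /=; move: j x; rewrite ic => j x; rewrite g_cycle scaler0.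
by rewrite mxE scale0r.
Defined.

End FreeMap.

Section Classification.
Variables (A : comNzRingType) (u : A) (n : nat).
Hypothesis Ach : chain_ring u n.
Implicit Types X Y : cpx A.

Lemma fin_gen_nat (M : lmodType A) : fin_gen M ->
  exists (r : nat) (e : nat -> M), forall x, exists c : nat -> A,
    x = \sum_(j < r) c j *: e j.
Proof.
move=> [r [e eP]]; exists r, (fun j => if insub j is Some j' then e j' else 0).
move=> x; have [c ->] := eP x.
exists (fun j => if insub j is Some j' then c j' else 0).
by apply: eq_bigr => j _; rewrite !valK.
Qed.

Section Truncate.
Variables (X : cpx A) (b : int).

Definition truncate_submod i : submod (X i).
Proof.
refine (@Submod A (X i)
  (fun x => [\/ i < b, i = b /\ diff X i x = 0 | x = 0]) _ _).
  exact: Or33.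
move=> a x y [ib | [ib dx] | ->]; first by move=> _; apply: Or31.
  case=> [ib' | [_ dy] | ->]; first exact: Or31.
    by apply: Or32; split=> //; rewrite linearP dx dy scaler0 addr0.
  by apply: Or32; split=> //; rewrite addr0 linearZ /= dx scaler0.
by rewrite scaler0 add0r.
Defined.

Fact truncate_diff i x :
  truncate_submod i x -> truncate_submod (i + 1) (diff X i x).
Proof.
case=> [ib | [_ ->] | ->]; last by rewrite linear0; apply: Or33.
  have [ib'|] := ltP (i + 1) b; first exact: Or31.
  by move=> bi; apply: Or32; split; [lia | rewrite diffK].
exact: Or33.
Qed.

Definition truncate : cpx A := subcx Ach truncate_diff.

End Truncate.

(** The cone of a free cover of the top term is isomorphic to [X] and has no cohomology in degree
    [b + 1], so it can be truncated. The free module sits in degree [b] of the cone, hence the lower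
    bound [a] survives. *)
Lemma drop_top (X : cpx A) (a b : int) : (a <= b)%R ->
  concentrated X a (b + 1) ->
  exists2 Y : cpx A, isomorphic (X : Dsg A) (Y : Dsg A) & concentrated Y a b.
Proof.
move=> ab X0; have [r [e eP]] := fin_gen_nat (term_fin_gen X (b + 1)).
pose g := dfwith (fun i (_ : nat) => 0 : X i) e.
have gc j : diff X (b + 1) (g _ j) = 0.
  by apply: X0; apply/orP; right; lia.
pose f := free_map r gc; pose C := cone f.
have f_surj i (x : X i) : i = b + 1 -> exists v, f i v = x.
  move=> ib; rewrite ib in x *; have [c xE] := eP x.
  exists (\row_j c j); rewrite xE /= /g.
  have E : free_rank (b + 1) r (b + 1) = r by rewrite /free_rank eqxx.
  under eq_bigr do rewrite mxE dfwith_in.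
  by rewrite -!(big_mkord xpredT (fun j => c j *: e j)) E.
have F0 i : i != b + 1 -> forall v : free_cpx A (b + 1) r i, v = 0.
  by rewrite /= /free_rank => /negPf -> v; rewrite thinmx0.
exists (truncate C b).
  apply: isomorphic_trans (_ : isomorphic (C : Dsg A) _).
    by exists (to_Dsg (cone_incl f)); apply/cone_incl_iso/free_perfect.
  apply: isomorphic_sym; pose q : cmap (truncate C b) C := sub_incl _ _.
  exists (to_Dsg q); apply/qis_iso/inj_qis => [i x x0 | i y [x xE]].
    exact: val_inj.
  have [ib|ib|ib] := ltgtP (i + 1) b.
  - have yU : truncate_submod C b (i + 1) y by apply: Or31.
    by exists 0, (sm_sub yU); rewrite linear0 add0r.
  - have [ib'|ib'] := eqVneq i b.
      have [v vE] : exists v, f (i + 1) v = y.2 by apply: f_surj; rewrite ib'.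
      exists (v, 0), 0; rewrite linear0 addr0 (surjective_pairing y).
      congr pair; rewrite /= ?linear0 ?addr0 ?oppr0 //.
      by apply: F0; rewrite ib'; lia.
    exists 0, 0; rewrite !linear0 addr0 (surjective_pairing y); congr pair.
      by apply: F0; lia.
    by apply: X0; apply/orP; right; lia.
  - have dy : diff C (i + 1) y = 0.
      by rewrite -xE; case: (sm_mem x) => [|[]|//]; lia.
    have yU : truncate_submod C b (i + 1) y by apply: Or32.
    by exists 0, (sm_sub yU); rewrite linear0 add0r.
move=> i ib x; apply: val_inj => /=.
have [ia|ia] := ltP i a.
  rewrite [\val x]surjective_pairing; congr pair; first by apply: F0; lia.
  by apply: X0; rewrite ia.
by case: (sm_mem x) => [|[]|//]; lia.
Qed.

Lemma drop_tops (X : cpx A) (a : int) (m : nat) :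
  concentrated X a (a + m%:Z) ->
  exists2 Y : cpx A, isomorphic (X : Dsg A) (Y : Dsg A) & concentrated Y a a.
Proof.
elim: m X => [|m IHm] X X0.
  by exists X; [exists (idm (X : Dsg A)); apply:
    is_iso_id | rewrite addr0 in X0].
have [||Y XY Y0] := @drop_top X a (a + m%:Z); first by lia.
  by move=> i ai; apply: X0; lia.
have [Z YZ Z0] := IHm Y Y0.
by exists Z => //; apply: isomorphic_trans YZ.
Qed.

Lemma row1_eq0 m (v : 'rV[A]_m) : m = 1%N -> \sum_j v 0 j = 0 -> v = 0.
Proof.
move=> m1; rewrite m1 in v *; rewrite big_ord1 => v0.
by apply/rowP => j; rewrite ord1 v0 mxE.
Qed.

(** * Splitting off a cyclic summand *)

Section Split.
Variables (X : cpx A) (c : int) (r : nat) (g : 'I_r.+1 -> forall i, X i).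
Hypothesis Xc : concentrated X c c.
Hypothesis gP : forall x : X c, exists a, x = \sum_l a l *: g l c.

Lemma concentrated_eq0 i (x : X i) : i != c -> x = 0.
Proof. by rewrite neq_lt => ic; apply: Xc. Qed.

Lemma concentrated_diff i (x : X i) : diff X i x = 0.
Proof.
have [ic|ic] := eqVneq i c; first by apply: concentrated_eq0; lia.
by rewrite (concentrated_eq0 x ic) linear0.
Qed.

(* The Smith normal form step: the relation among the generators having a
   coefficient of least order [p] exhibits a generator killed by [u ^+ p] and
   independent of all but one of the [g l]. *)
Lemma smith_step : exists (p : nat) (l0 : 'I_r.+1) (w w' : A) (a :
  'I_r.+1 -> A),
  let e := \sum_l a l *: g l c in
  [/\ (p <= n)%N, w * w' = 1, a l0 = w, u ^+ p *: e = 0 &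
    forall b : 'I_r.+1 -> A, \sum_l b l *: g l c = 0 ->
      exists s, b l0 = u ^+ p * s].
Proof.
pose P x := exists2 b : 'I_r.+1 -> A, \sum_l b l *: g l c = 0 &
  exists l, x = b l.
have [|p [w [w' [pn ww [b b0 [l0 bl0]] Pmin]]]] := min_exponent Ach (P := P).
  exists (fun=> 0); last by exists ord0.
  by rewrite big1 // => l _; rewrite scale0r.
have /choice [a aE] l : exists a, b l = u ^+ p * a.
  by apply: Pmin; exists b => //; exists l.
exists p, l0, w, w', (fun l => if l == l0 then w else a l); split=> //.
- by rewrite eqxx.
- rewrite scaler_sumr -[RHS]b0; apply: eq_bigr => l _; rewrite scalerA.
  by case: eqP => [->|_]; rewrite -?bl0 -?aE.
- by move=> d d0; apply: Pmin; exists d => //; exists l0.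
Qed.

Definition rest_submod (l0 : 'I_r.+1) i : submod (X i) :=
  span_submod (fun l => g (lift l0 l) i).

Fact rest_diff l0 i x :
  rest_submod l0 i x -> rest_submod l0 (i + 1) (diff X i x).
Proof. by move=> _; rewrite concentrated_diff; apply: smem0. Qed.

Definition rest l0 : cpx A := subcx Ach (@rest_diff l0).

Section CyclicMap.
Variables (p : nat) (pn : (p <= n)%N) (e : forall i, X i).
Hypothesis pe : forall i, u ^+ p *: e i = 0.

(** M_p is an ideal here, not a quotient, so a map out of it divides by u^(n-p). The quotient is
    unique only up to multiples of u^p, which [e] does not see. Summing its coordinates reads the
    single entry in degree [c] and gives 0 elsewhere. *)
Definition cyc_lift i (x : cyc Ach c p i) : 'rV[A]_(free_rank c 1 i) :=
  sval (cid (cyc_ann pn (cyc_mem x))).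

Lemma cyc_liftE i (x : cyc Ach c p i) :
  \val x = u ^+ (n - p) *: cyc_lift x.
Proof. exact: (svalP (cid (cyc_ann pn (cyc_mem x)))). Qed.

Lemma cyc_lift_uniq i (v w : 'rV[A]_(free_rank c 1 i)) :
  u ^+ (n - p) *: v = u ^+ (n - p) *: w ->
  (\sum_j v 0 j) *: e i = (\sum_j w 0 j) *: e i.
Proof.
move=> /eqP; rewrite -subr_eq0 -scalerBr => /eqP /(rV_ann Ach (leq_subr p n)).
rewrite subKn // => -[y vwE]; apply/eqP; rewrite -subr_eq0 -scalerBl -sumrB.
have -> : \sum_j (v 0 j - w 0 j) = (\sum_j y 0 j) * u ^+ p.
  rewrite mulr_suml; apply: eq_bigr => j _.
  by move/rowP/(_ j): vwE; rewrite !mxE mulrC.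
by rewrite -scalerA pe scaler0.
Qed.

Fact cyc_map_linear i :
  linear (fun x : cyc Ach c p i => (\sum_j cyc_lift x 0 j) *: e i).
Proof.
move=> a x y; rewrite scalerA mulr_sumr -scalerDl -big_split /=.
pose v := a *: cyc_lift x + cyc_lift y.
transitivity ((\sum_j v 0 j) *: e i).
  apply: cyc_lift_uniq; rewrite -cyc_liftE scalerDr -cyc_liftE.
  by rewrite scalerA mulrC -scalerA -cyc_liftE.
by congr (_ *: _); apply: eq_bigr => j _; rewrite !mxE.
Qed.

Definition cyc_map : cmap (cyc Ach c p) X.
Proof.
refine (@Cmap A (cyc Ach c p) X (fun i => mklin (@cyc_map_linear i)) _) => i x.
by rewrite cyc_diff linear0 concentrated_diff.
Defined.

End CyclicMap.

(** The map sending the generator of M_p to [e] and including the rest is bijective: the coefficient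
    [w] of [g l0] in [e] is a unit, and every relation has its [l0] coefficient in (u^p). *)
Lemma split_cyclic : exists (p : nat) (l0 : 'I_r.+1), (p <= n)%N /\
  isomorphic (sum_cpx (cyc Ach c p) (rest l0) : Dsg A) (X : Dsg A).
Proof.
have [p [l0 [w [w' [a [pn ww al0 pe b_min]]]]]] := smith_step.
exists p, l0; split=> //; pose e i : X i := \sum_l a l *: g l i.
have pe' i : u ^+ p *: e i = 0.
  by have [->//|ic] := eqVneq i c; apply: concentrated_eq0.
pose f := ccop (cyc_map pn pe') (sub_incl _ _ : cmap (rest l0) X).
have rank1 : free_rank c 1 c = 1%N by rewrite /free_rank eqxx.
have cyc0 i (x : cyc Ach c p i) : i != c -> x = 0.
  move=> ic; apply: val_inj; move: (\val x).
  by rewrite /= /free_rank (negPf ic) => v; rewrite [v]thinmx0 [RHS]thinmx0.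
exists (to_Dsg f); apply: bij_iso => [i [x y] | i y].
  have [ic|ic] := eqVneq i c; last first.
    move=> _; rewrite (cyc0 _ x ic); congr pair; apply: val_inj.
    exact: concentrated_eq0.
  case: _ / (esym ic) in x y *; rewrite /= => fxy.
  have [d yE] := sm_mem y; set s := \sum_j _ in fxy.
  pose b l := s * a l + (if unlift l0 l is Some l' then d l' else 0).
  have [|t bl0] := b_min b.
    rewrite -[RHS]fxy /e scaler_sumr yE.
    transitivity (\sum_l (s *: (a l *: g l c) +
        (if unlift l0 l is Some l' then d l' else 0) *: g l c)).
      by apply: eq_bigr => l _; rewrite scalerDl scalerA.
    rewrite big_split /=; congr (_ + _).
    rewrite (bigD1_ord l0) //= unlift_none scale0r add0r.
    by apply: eq_bigr => l _; rewrite liftK.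
  (* The [l0] coefficient of the relation [b] is [s * w], so [u ^+ p] divides [s]. This kills both
     [s *: e] and the coordinate [u ^+ (n - p) * s] of [x]. *)
  have sE : s = t * w' * u ^+ p.
    have E : s * a l0 = u ^+ p * t by rewrite -bl0 /b unlift_none addr0.
    by rewrite -[LHS]mulr1 -ww mulrA -al0 E -mulrA mulrC.
  have x0 : x = 0.
    apply: val_inj; apply: row1_eq0 rank1 _.
    rewrite (cyc_liftE pn x).
    under eq_bigr do rewrite mxE.
    rewrite -mulr_sumr -/s sE mulrCA -exprD subnK //.
    by rewrite (chain_nilp Ach) mulr0.
  rewrite x0; congr pair; apply: val_inj; move: fxy.
  by rewrite sE -scalerA pe' scaler0 add0r.
have [ic|ic] := eqVneq i c; last first.
  by exists 0; rewrite linear0 (concentrated_eq0 y ic).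
case: _ / (esym ic) in y *; have [b yE] := gP y.
(* The multiple [b l0 * w'] of [e] has the same [l0] coefficient as [y]; the difference lies in
   [rest]. *)
pose v : 'rV[A]_(free_rank c 1 c) := const_mx (b l0 * w').
have vM : tors_submod u (free_cpx A c 1 c) p (u ^+ (n - p) *: v).
  by rewrite /= scalerA -exprD subnKC // (chain_nilp Ach) scale0r.
have zM : rest_submod l0 c
    (\sum_l (b (lift l0 l) - b l0 * w' * a (lift l0 l)) *: g (lift l0 l) c).
  by exists (fun l => b (lift l0 l) - b l0 * w' * a (lift l0 l)).
exists (sm_sub vM : cyc Ach c p c, sm_sub zM); rewrite /=.
have -> : (\sum_j cyc_lift pn (sm_sub vM) 0 j) *: e c = (b l0 * w') *: e c.
  rewrite (cyc_lift_uniq pn pe' (w := v)) -?cyc_liftE //.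
  under eq_bigr do rewrite mxE.
  by rewrite sumr_const card_ord rank1 mulr1n.
rewrite yE /e !(bigD1_ord l0)
  //= scalerDr al0 scalerA -mulrA (mulrC w') ww mulr1.
rewrite -addrA; congr (_ + _); rewrite scaler_sumr -big_split /=.
by apply: eq_bigr => l _; rewrite scalerA scalerBl addrC subrK.
Qed.

End Split.

Local Notation cy c p := (cyc Ach c p : Dsg A).

(** Cyclic summands are split off one generator at a time. The decomposition is recorded as
    membership in closures in both directions, the form in which generation uses it. *)
Lemma concentrated_classify (c : int) r (X : cpx A)
    (g : 'I_r -> forall i, X i) : concentrated X c c ->
  (forall x : X c, exists a, x = \sum_l a l *: g l c) ->
  exists L : seq nat, [/\ forall p, p \in L -> (p <= n)%N,
    forall p, p \in L -> clo (fun Y : Dsg A => Y = X) (cy c p) &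
    clo (fun Y : Dsg A => exists2 p, p \in L & Y = cy c p) X].
Proof.
elim: r X g => [|r IHr] X g Xc gP.
  exists [::]; split=> //; apply: clo_iso (clo_zero (Dsg_coprods A) _).
  exists (to_Dsg (null_map (zero_cpx A) X)); apply: bij_iso => i x.
    by rewrite [x]thinmx0.
  exists 0; rewrite linear0; have [ic|ic] := eqVneq i c; last first.
    by rewrite (concentrated_eq0 Xc x ic).
  by case: _ / (esym ic) in x *; have [a ->] := gP x; rewrite big_ord0.
have [p [l0 [pn iso]]] := split_cyclic Xc gP.
have gM (l : 'I_r) i : rest_submod g l0 i (g (lift l0 l) i).
  exists (fun l' => (l' == l)%:R); rewrite (bigD1 l) //= eqxx scale1r big1
    ?addr0 //.
  by move=> l' /negPf ->; rewrite scale0r.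
have [|x|L [Ln LX XL]] := IHr (rest g Xc l0) (fun l i => sm_sub (gM l i)).
- by move=> i ic x; apply: val_inj; apply: (Xc i ic).
- have [a xE] := sm_mem x; exists a; apply: val_inj; rewrite raddf_sum /=.
  exact: xE.
have sumX I : clo I (sum_cpx (cyc Ach c p) (rest g Xc l0) : Dsg A) <->
    clo I (X : Dsg A).
  by split; apply: clo_iso => //; apply: isomorphic_sym.
exists (p :: L); split.
- by move=> q; rewrite inE => /predU1P[-> //|/Ln].
- move=> q; rewrite inE => /predU1P[->|qL].
    by apply: (@clo_sum1 (Dsg A) (Dsg_coprods A)); apply/sumX/clo_in.
  apply: clo_min (LX q qL) => _ ->.
  by apply: (@clo_sum2 (Dsg A) (Dsg_coprods A)); apply/sumX/clo_in.
apply/sumX; apply: (@clo_sum (Dsg A) (Dsg_coprods A)).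
  by apply: clo_in; exists p; rewrite ?inE ?eqxx.
apply: clo_min XL => _ [q qL ->]; apply: clo_in; exists q => //.
by rewrite inE qL orbT.
Qed.

Lemma classify (X : cpx A) : exists (c : int) (L : seq nat),
  [/\ forall p, p \in L -> (p <= n)%N,
    forall p, p \in L -> clo (fun Y : Dsg A => Y = X) (cy c p) &
    clo (fun Y : Dsg A => exists2 p, p \in L & Y = cy c p) X].
Proof.
have [b Xb] := cpx_bounded X.
have [|Y XY Yc] := @drop_tops X (- b%:Z) (b + b) _.
  by move=> i ib; apply: Xb; lia.
have [m [e eP]] := term_fin_gen Y (- b%:Z).
pose g (l : 'I_m) := dfwith (fun i => 0 : Y i) (e l).
have [|L [Ln LY YL]] := concentrated_classify (g := g) Yc.
  move=> y; have [a yE] := eP y; exists a; rewrite yE.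
  by apply: eq_bigr => l _; rewrite /g dfwith_in.
exists (- b%:Z), L; split=> // [p pL|].
  apply: clo_min (LY p pL) => _ ->.
  by apply: clo_iso XY _; apply: clo_in.
by apply: clo_iso YL; apply: isomorphic_sym.
Qed.

End Classification.

(** * Tate cohomology *)

(** Differentials land in degrees [i + 1], so families arise indexed by successors. Every [j] is
    [j - 1 + 1], up to a cast that is harmless because equality proofs on [int] are unique. *)
Lemma unshift (T : int -> Type) (x : forall i, T (i + 1)) :
  exists y : forall i, T i, forall i, y (i + 1) = x i.
Proof.
have H j : exists y : T j, forall i (e : i + 1 = j), eq_rect _ T (x i) j e = y.
  rewrite -(subrK 1 j); exists (x (j - 1)) => i e.
  have ij := addIr 1 e; case: _ / (esym ij) in e *.
  by rewrite (eq_irrelevance e erefl).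
exists (fun j => sval (cid (H j))) => i.
by rewrite -(svalP (cid (H (i + 1))) i erefl).
Qed.

Lemma int_succ_ind (P : int -> Prop) : (forall i, P (i + 1)) -> forall i, P i.
Proof. by move=> PS i; rewrite -(subrK 1 i). Qed.

Section Tate.
Variables (A : comNzRingType) (u : A) (n m : nat).
Hypothesis Ach : chain_ring u n.
Hypothesis mn : (m <= n)%N.
Implicit Types X Y : cpx A.

(* Tate cohomology is the cohomology of [P (x) X], where
   [P = (... -> A -> A -> A -> ...)] is the complete resolution with
   differentials alternately [u ^+ m] and [u ^+ (n - m)].  An element of total
   degree [N] is a family indexed by the degree [i] in [X], and [tw N i] is
   the signed differential of [P] from degree [N - i]. *)
Definition tw (N i : int) : A :=
  (-1) ^+ `|i| * u ^+ (if odd `|N - i| then (n - m)%N else m).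

Lemma twS N i : tw N (i + 1) = - tw (N - 1) i.
Proof.
rewrite /tw (_ : N - (i + 1) = N - 1 - i); last by lia.
have -> : (-1) ^+ `|i + 1| = - (-1) ^+ `|i| :> A.
  by rewrite -signr_odd -[in RHS]signr_odd (_ :
    odd `|(i + 1)%R| = ~~ odd `|i|) ?signrN //; lia.
by rewrite mulNr.
Qed.

Lemma twK N i : tw N i * tw (N - 1) i = 0.
Proof.
rewrite /tw mulrACA -[in X in _ * X]exprD (_ : (_ + _)%N = n)
  ?(chain_nilp Ach) ?mulr0 //.
have -> : odd `|(N - 1 - i)%R| = ~~ odd `|(N - i)%R| by lia.
by case: odd => /=; lia.
Qed.

Definition tate_cycle X N (x : forall i, X i) : Prop :=
  forall i, diff X i (x i) + tw N (i + 1) *: x (i + 1) = 0.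

Definition tate_bound X N (x : forall i, X i) : Prop :=
  exists z : forall i, X i, forall i,
    x (i + 1) = diff X i (z i) + tw (N - 1) (i + 1) *: z (i + 1).

Record tate_el X N := TateEl {
  tate_val :> forall i, X i;
  tate_valP : tate_cycle N tate_val
}.

Definition tate_eqv X N (x y : tate_el X N) : Prop :=
  tate_bound N (fun i => x i - y i).

Fact tate_refl X N (x : tate_el X N) : tate_eqv x x.
Proof. by exists (fun=> 0) => i; rewrite subrr linear0 scaler0 addr0. Qed.

Fact tate_sym X N (x y : tate_el X N) : tate_eqv x y -> tate_eqv y x.
Proof.
move=> [z zP]; exists (fun i => - z i) => i.
by rewrite linearN scalerN -opprD -zP opprB.
Qed.

Fact tate_trans X N (x y w : tate_el X N) :
  tate_eqv x y -> tate_eqv y w -> tate_eqv x w.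
Proof.
move=> [z zP] [v vP]; exists (fun i => z i + v i) => i.
by rewrite linearD scalerDr addrACA -zP -vP addrA subrK.
Qed.

Fact tate_pt_cycle X N : tate_cycle N (fun i => 0 : X i).
Proof. by move=> i; rewrite linear0 scaler0 addr0. Qed.

Definition tate_pt X N := TateEl (@tate_pt_cycle X N).

Fact tate_act_cycle X N (x : tate_el X N) : tate_cycle N (fun i => u *: x i).
Proof.
move=> i; rewrite linearZ /= !scalerA mulrC -scalerA -scalerDr.
by rewrite tate_valP scaler0.
Qed.

Definition tate_act X N (x : tate_el X N) := TateEl (tate_act_cycle x).

Fact tate_act_eqv X N (x y : tate_el X N) :
  tate_eqv x y -> tate_eqv (tate_act x) (tate_act y).
Proof.
move=> [z zP]; exists (fun i => u *: z i) => i.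
by rewrite /= -scalerBr zP linearZ scalerDr /= !scalerA mulrC.
Qed.

Fact tate_map_cycle X Y (f : cmap X Y) N (x : tate_el X N) :
  tate_cycle N (fun i => f i (x i)).
Proof.
by move=> i; rewrite -cmapE -linearZ -linearD tate_valP linear0.
Qed.

Definition tate_map X Y (f : cmap X Y) N (x : tate_el X N) :=
  TateEl (tate_map_cycle f x).

Fact tate_map_eqv X Y (f : cmap X Y) N (x y : tate_el X N) :
  tate_eqv x y -> tate_eqv (tate_map f x) (tate_map f y).
Proof.
move=> [z zP]; exists (fun i => f i (z i)) => i.
by rewrite /= -linearB zP linearD linearZ /= cmapE.
Qed.

Fact tate_map_htpy X Y (f g : cmap X Y) : homotopic f g ->
  forall N (x : tate_el X N), tate_eqv (tate_map f x) (tate_map g x).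
Proof.
move=> [h hP] N x; exists (fun i => h i (x (i + 1))) => i; rewrite /= hP.
congr (_ + _); rewrite -[tw _ _]opprK -twS scaleNr -linearZ -linearN.
by congr (h _ _); apply/eqP; rewrite -addr_eq0 (tate_valP x).
Qed.

Lemma tate_eq_eqv X N (x y : tate_el X N) :
  (forall i, x i = y i) -> tate_eqv x y.
Proof.
by move=> xy; exists (fun=> 0) => i; rewrite xy subrr linear0 scaler0 addr0.
Qed.

Definition tate : hfun (Kb A).
Proof.
refine (@Hfun (Kb A) tate_el tate_eqv tate_refl tate_sym tate_trans tate_pt
  tate_act tate_act_eqv _ tate_map tate_map_eqv tate_map_htpy _ _ _ _) => *;
  apply: tate_eq_eqv => i //=.
- by rewrite scaler0.
- by rewrite linear0.
- by rewrite linearZ.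
Defined.

(** If [z] bounds the image of [y] in the cone, its first component is a cycle [x] of [X], and its
    second component bounds [y - f x]. *)
Lemma tate_exact_std X Y (f : cmap X Y) :
  exact_at tate (f : @hom (Kb A) X Y) (cone_incl f : @hom (Kb A) Y (cone f)).
Proof.
move=> N y [z zP]; have [x xP] := @unshift (fun j => X j) (fun i => (z i).1).
have z1 i : diff X (i + 1) (z i).1 = tw (N - 1) (i + 1) *: (z (i + 1)).1.
  have [E _] := zP i; apply/esym/eqP; rewrite -subr_eq0 (addrC (_ *: _)).
  by rewrite -E subrr.
have z2 i : y (i + 1) = f (i + 1) (z i).1 + (diff Y i (z i).2
    + tw (N - 1) (i + 1) *: (z (i + 1)).2).
  by have [_ E] := zP i; rewrite addrA -E subr0.
have xN : tate_cycle N x.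
  by apply: int_succ_ind => i; rewrite !xP z1 (twS N) scaleNr subrr.
exists (TateEl xN); exists (fun i => - (z i).2) => i.
by rewrite /= xP z2 opprD addrA subrr add0r linearN scalerN -opprD.
Qed.

(** For injectivity, if [z] bounds [f x - f x'], then [(x - x', - z)] is a cycle of the cone;
    whatever bounds it has a first component that bounds [x - x'] up to sign. *)
Lemma tate_bij_std X Y (f : cmap X Y) :
  vanishes tate (cone f : Kb A) -> bijective_on tate (f : @hom (Kb A) X Y).
Proof.
move=> C0; split=> N; first by move=> y; apply: tate_exact_std; apply: C0.
move=> x x' [z zP]; pose w i := x i - x' i.
have wN i : diff X i (w i) = - (tw N (i + 1) *: w (i + 1)).
  apply/eqP; rewrite -addr_eq0 linearB scalerBr addrACA -opprD.
  by rewrite !tate_valP subr0.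
pose c i : cone f i := (w (i + 1), - z i).
have cN : tate_cycle (N - 1) c.
  move=> i; congr pair; rewrite /=.
    by rewrite wN opprK twS scaleNr addNr.
  by rewrite linearB /= zP linearN scalerN addrAC addrK subrr.
have [p pP] := C0 _ (TateEl cN).
have [v vP] := @unshift (fun j => X j) (fun i => - (p i).1).
exists v; apply: int_succ_ind => i; rewrite -/(w _).
have [E _] := pP i; move: E; rewrite /= subr0 => ->.
by rewrite !vP linearN (twS (N - 1)) scaleNr scalerN opprK.
Qed.

Lemma tate_exact : exact_hfun tate.
Proof.
move=> X Y Z f g h [X' [Y' [v I]]].
apply: (@exact_tri_iso (Kb A) tate _ _ _ _ _ _ _ _ _ _ _ _ I).
by split; [apply: tate_exact_std | apply: tate_bij_std].
Qed.

Lemma tate_vanishes X : (forall N (x : forall i, X i), tate_cycle N x ->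
  tate_bound N x) -> vanishes tate (X : Kb A).
Proof.
move=> X0 N x; have [z zP] := X0 N x (tate_valP x).
by exists z => i; rewrite /= subr0.
Qed.

(** A bounding family is built downwards from the top degree, each new term being solved for along
    the exact differential of [X]. *)
Lemma tate_acyclic X : acyclic X -> vanishes tate (X : Kb A).
Proof.
move=> Xac; apply: tate_vanishes => N x xN; have [b Xb] := cpx_bounded X.
have H (k : nat) : exists z : forall i, X i, forall i, b%:Z - k%:Z <= i ->
    x (i + 1) = diff X i (z i) + tw (N - 1) (i + 1) *: z (i + 1).
  elim: k => [|k [z zP]].
    exists (fun=> 0) => i bi; rewrite linear0 scaler0 addr0; apply: Xb; lia.
  pose s := b%:Z - k.+1%:Z.
  have [|y yE] := Xac s (x (s + 1) - tw (N - 1) (s + 1) *: z (s + 1)).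
    rewrite linearB linearZ /=; have /eqP := xN (s + 1).
    rewrite addr_eq0 => /eqP ->; rewrite zP; last by rewrite /s; lia.
    rewrite scalerDr scalerA twK scale0r addr0 twS scaleNr opprK.
    by rewrite subrr.
  exists (dfwith z y) => i si; have [->|ni] := eqVneq i s.
    rewrite dfwith_in dfwith_out; last by lia.
    by rewrite yE subrK.
  rewrite !dfwith_out; try by lia.
  by apply: zP; move: si ni; rewrite /s; lia.
(* This covers all [i >= - b - 2]; below that, both sides of the equation lie in a zero term. *)
have [z zP] := H (b + b).+2; exists z => i.
have [bi|bi] := leP (b%:Z - (b + b).+2%:Z) i; first exact: zP.
by rewrite [LHS]Xb ?[RHS]Xb //; lia.
Qed.

(** [P] is a retract of a free module, where [rV_ann] divides; the quotient is mapped back to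
    [P]. *)
Lemma projective_ann (P : lmodType A) (e : nat) (x : P) :
  fin_gen P -> projective P -> (e <= n)%N -> u ^+ e *: x = 0 ->
  exists y, x = u ^+ (n - e) *: y.
Proof.
move=> [r [g gP]] Pp en ux0.
have pL : linear (fun v : 'rV[A]_r => \sum_j v 0 j *: g j).
  move=> a v w; rewrite scaler_sumr -big_split; apply: eq_bigr => j _ /=.
  by rewrite !mxE scalerDl scalerA.
have [|s sP] := Pp _ _ (mklin pL) (idfun : {linear P -> P}).
  move=> y; have [c ->] := gP y; exists (\row_j c j).
  by apply: eq_bigr => j _; rewrite mxE.
have [|v vE] := rV_ann Ach (x := s x) en.
  by rewrite -linearZ /= ux0 linear0.
by exists (mklin pL v); rewrite -linearZ /= -vE -[LHS]sP.
Qed.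

(** The complete resolution stays exact after tensoring with a projective module; the sign [e]
    squares to 1 and cancels. *)
Lemma tate_column (P : lmodType A) N i (x : P) :
  fin_gen P -> projective P -> tw N i *: x = 0 ->
  exists y, x = tw (N - 1) i *: y.
Proof.
move=> Pg Pp; set e := (-1) ^+ `|i| : A.
have ee : e * e = 1 by rewrite /e -signr_odd -expr2 sqrr_sign.
rewrite /tw -/e -scalerA => /(congr1 (fun y => e *: y)).
rewrite (scalerA e e) ee scale1r scaler0.
move=> /(projective_ann Pg Pp) [|y ->]; first by case: ifP => _ //; lia.
exists (e *: y); rewrite scalerA mulrAC ee.
rewrite mul1r (_ : odd `|(N - 1 - i)%R| = ~~ odd `|(N - i)%R|); last by lia.
by case: odd => //=; congr (u ^+ _ *: _); lia.
Qed.

(** Mirror image of [tate_acyclic]: the bounding family is built upwards from the bottom degree, now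
    solving along the differential of the resolution. *)
Lemma tate_perfect X : perfect X -> vanishes tate (X : Kb A).
Proof.
move=> Xp; apply: tate_vanishes => N x xN; have [b Xb] := cpx_bounded X.
have H (k : nat) : exists z : forall i, X i, forall i, i <= k%:Z - b.+2%:Z ->
    x (i + 1) = diff X i (z i) + tw (N - 1) (i + 1) *: z (i + 1).
  elim: k => [|k [z zP]].
    exists (fun=> 0) => i bi; rewrite linear0 scaler0 addr0; apply: Xb; lia.
  pose s := k%:Z - b.+2%:Z.
  have [|y yE] := @tate_column (X (s + 1 + 1)) N (s + 1 + 1)
      (x (s + 1 + 1) - diff X (s + 1) (z (s + 1))) (term_fin_gen X _) (Xp _).
    have E := xN (s + 1); rewrite {1}zP // linearD diffK add0r linearZ /= in E.
    by rewrite scalerBr {2}(twS N) scaleNr opprK (addrC (_ *: x _)).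
  exists (dfwith z y) => i si; have [->|ni] := eqVneq i (s + 1).
    rewrite dfwith_in dfwith_out; last by lia.
    by rewrite -yE (addrC (diff _ _ _)) subrK.
  rewrite !dfwith_out; try by move: si ni; rewrite /s; lia.
  by apply: zP; move: si ni; rewrite /s; lia.
have [z zP] := H (b + b).+2; exists z => i.
have [bi|bi] := leP i ((b + b).+2%:Z - b.+2%:Z); first exact: zP.
by rewrite [LHS]Xb ?[RHS]Xb //; lia.
Qed.

Definition tate_Db : hfun (Db A) :=
  verdier_hfun (Kb_ok A) (@acyclic_shift A) tate_exact tate_acyclic.

Lemma tate_Db_exact : exact_hfun tate_Db.
Proof. exact: verdier_hfun_exact. Qed.

Definition tate_Dsg : hfun (Dsg A) :=
  verdier_hfun (Db_ok A) (@perfect_shift A) tate_Db_exact tate_perfect.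

Lemma tate_Dsg_exact : exact_hfun tate_Dsg.
Proof. exact: verdier_hfun_exact. Qed.

Lemma tate_iter X N a (x : tate_el X N) i :
  iter a (@tate_act X N) x i = u ^+ a *: x i.
Proof.
by elim: a => [|a IHa] /=; rewrite ?scale1r // IHa scalerA -exprS.
Qed.

(** [verdier_hfun] keeps elements and their equivalence, so killing in [Dsg] can be tested on
    families in the complex. *)
Lemma tate_killsP a X : kills tate_Dsg a (X : Dsg A) <->
  forall N (x : forall i, X i), tate_cycle N x ->
    tate_bound N (fun i => u ^+ a *: x i).
Proof.
split=> K N x => [xN|].
  have [z zP] := K N (TateEl xN); exists z => i.
  by apply: etrans (zP i); rewrite subr0; apply/esym/tate_iter.
have [z zP] := K N _ (tate_valP x); exists z => i.
by apply: etrans (zP i); rewrite subr0; apply: tate_iter.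
Qed.

(** Shifting [X] moves the total degree by one; [twS] matches the sign of the shifted
    differential. *)
Lemma tate_kills_sh a X :
  kills tate_Dsg a (sh (X : Dsg A)) <-> kills tate_Dsg a (X : Dsg A).
Proof.
rewrite !tate_killsP; split=> K N x xN.
  have [|z zP] := K (N - 1) (fun i => x (i + 1)).
    by move=> i; rewrite /= -[tw _ _]opprK -twS scaleNr -opprD xN oppr0.
  have [v vP] := @unshift (fun j => X j) (fun i => - z i).
  exists v; apply: int_succ_ind => i; rewrite zP !vP /=.
  by rewrite linearN (twS (N - 1)) scaleNr scalerN opprK.
have [y yP] := @unshift (fun j => X j) x.
have [|z zP] := K (N + 1) y.
  apply: int_succ_ind => i; rewrite !yP twS addrK scaleNr.
  by apply: oppr_inj; rewrite opprD opprK oppr0; apply: xN.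
exists (fun i => - z (i + 1)) => i.
rewrite -yP; apply: etrans (zP (i + 1)) _.
by rewrite addrK (twS N) /= linearN opprK scaleNr scalerN.
Qed.

Lemma tate_kills_zero a : kills tate_Dsg a (zero (Dsg_coprods A)).
Proof.
apply/tate_killsP => N x _; exists (fun=> 0) => i.
by rewrite [LHS]thinmx0 [RHS]thinmx0.
Qed.

Lemma tate_kills_sum a (X Y : Dsg A) :
  kills tate_Dsg a (sum (Dsg_coprods A) X Y) <->
  kills tate_Dsg a X /\ kills tate_Dsg a Y.
Proof.
rewrite !tate_killsP; split=> [K | [KX KY] N x xN].
  split=> N x xN.
    have [|z zP] := K N (fun i => (x i, 0) : sum_cpx X Y i).
      by move=> i; congr pair; rewrite /= ?xN // linear0 scaler0 addr0.
    by exists (fun i => (z i).1) => i; have [] := zP i.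
  have [|z zP] := K N (fun i => (0, x i) : sum_cpx X Y i).
    by move=> i; congr pair; rewrite /= ?xN // linear0 scaler0 addr0.
  by exists (fun i => (z i).2) => i; have [] := zP i.
have [|z zP] := KX N (fun i => (x i).1); first by move=> i; have [] := xN i.
have [|v vP] := KY N (fun i => (x i).2); first by move=> i; have [] := xN i.
by exists (fun i => (z i, v i)) => i; congr pair; [apply: zP | apply: vP].
Qed.

End Tate.

(** * The Orlov spectrum over a uniserial ring *)

Lemma castmx_linear (A : comNzRingType) r r' (E : r = r') :
  linear (castmx (erefl 1%N, E) : 'rV[A]_r -> 'rV[A]_r').
Proof. by case: _ / E => a x y; rewrite !castmx_id. Qed.

Lemma castmx_eq0 (A : comNzRingType) r r' (E : r = r') (v : 'rV[A]_r) :
  castmx (erefl 1%N, E) v = 0 -> v = 0.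
Proof. by case: _ / E; rewrite castmx_id. Qed.

Lemma castmx_tors (A : comNzRingType) r r' (E : r = r') (a : A) (v : 'rV[A]_r) :
  a *: v = 0 -> a *: castmx (erefl 1%N, E) v = 0.
Proof. by case: _ / E; rewrite castmx_id. Qed.

Section Spectrum.
Variables (A : comNzRingType) (u : A) (n : nat).
Hypothesis Ach : chain_ring u n.
Hypothesis n_ge2 : (2 <= n)%N.

Local Notation m := n./2.
Local Notation cy c p := (cyc Ach c p : Dsg A).
Implicit Types G X Y : Dsg A.

Fact half_le : (m <= n)%N. Proof. by lia. Qed.

Local Notation kill := (kills (tate_Dsg Ach half_le)).

Lemma kill_cyc s c p : (p <= s)%N -> kill s (cy c p).
Proof.
move=> ps; apply/tate_killsP => N x _; exists (fun=> 0) => i.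
rewrite linear0 scaler0 addr0; apply: val_inj.
by rewrite /= -(subnK ps) exprD -scalerA cyc_mem scaler0.
Qed.

Lemma kill_cyc_min s c p : (p <= n)%N -> (minn p (n - p) <= s)%N ->
  kill s (cy c p).
Proof.
move=> pn; rewrite geq_min => /orP[|nps]; first exact: kill_cyc.
apply: kills_iso (isomorphic_sym (cyc_shift Ach c pn)) _.
by apply/tate_kills_sh/kill_cyc.
Qed.

(** Both u^m and u^(n-m) kill M_m, so its generator u^(n-m) is a cycle and all boundaries are zero;
    u^a times it is nonzero for a < m. *)
Lemma kill_half a : kill a (cy 0 m) -> (m <= a)%N.
Proof.
move=> /tate_killsP K; rewrite leqNgt; apply/negP => am.
have xM i : tors_submod u (free_cpx A 0 1 i) m (const_mx (u ^+ (n - m))).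
  apply/rowP => j; rewrite !mxE -exprD subnKC ?(chain_nilp Ach) //; exact:
    half_le.
have i0 i (x : cyc Ach 0 m (i + 1)) : tw u n m 0 (i + 1) *: x = 0.
  apply: val_inj; apply/rowP => j.
  have -> : tw u n m 0 (i + 1) = u ^+ m.
    by rewrite (free_rank_ord j) /tw /= expr0 mul1r.
  by rewrite [\val (_ *: _)]/= cyc_mem.
have [|z zP] := K 0 (fun i => sm_sub (xM i)).
  by move=> i; rewrite i0 cyc_diff addr0.
have i1 i (x : cyc Ach 0 m (i + 1)) : tw u n m (0 - 1) (i + 1) *: x = 0.
  apply: val_inj; apply/rowP => j.
  have -> : tw u n m (0 - 1) (i + 1) = u ^+ (n - m - m) * u ^+ m.
    rewrite (free_rank_ord j) /tw /= expr0 mul1r -exprD.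
    by congr (u ^+ _); lia.
  by rewrite [\val (_ *: _)]/= -scalerA cyc_mem scaler0.
have := zP (-1); rewrite i1 cyc_diff addr0 => /cyc_val ux.
have := congr1 (fun v : 'rV[A]_1 => v 0 0) ux.
rewrite !mxE -exprD => /eqP; apply/negP/(chain_order Ach); lia.
Qed.

(** The terms agree only up to an equality of ranks, whence the casts; both differentials are
    zero. *)
Lemma cyc_deshift c p : isomorphic (sh (cy (c + 1) p)) (cy c p).
Proof.
have E i : free_rank (c + 1) 1 (i + 1) = free_rank c 1 i.
  by rewrite /free_rank (inj_eq (addIr 1)).
pose f i : 'rV[A]_(free_rank (c + 1) 1 (i + 1)) -> 'rV[A]_(free_rank c 1 i) :=
  castmx (erefl 1%N, E i).
have fM i (x : shift (cyc Ach (c + 1) p) i) :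
    tors_submod u (free_cpx A c 1 i) p (f i (\val x)).
  exact: castmx_tors (cyc_mem (x : cyc Ach (c + 1) p (i + 1))).
have fL i : linear (fun x => sm_sub (fM i x) : cyc Ach c p i).
  by move=> a x y; apply: val_inj; rewrite /= /f castmx_linear.
have fE i x : mklin (fL (i + 1)) (diff (shift (cyc Ach (c + 1) p)) i x) =
    diff (cyc Ach c p) i (mklin (fL i) x).
  rewrite [RHS]cyc_diff -[RHS](linear0 (mklin (fL (i + 1)))); congr (mklin _ _).
  change (- diff (cyc Ach (c + 1) p) (i + 1) x = 0).
  by rewrite cyc_diff oppr0.
pose q := @Cmap A _ _ (fun i => mklin (fL i)) fE.
exists (to_Dsg q); apply: bij_iso => [i x /cyc_val /castmx_eq0 x0 | i y].
  exact: val_inj.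
have yM : tors_submod u (free_cpx A (c + 1) 1 (i + 1)) p
    (castmx (erefl 1%N, esym (E i)) (\val y)).
  exact: castmx_tors (cyc_mem y).
by exists (sm_sub yM); apply: val_inj; rewrite /= /f castmxKV.
Qed.

Lemma clo_cyc_degree I c c' p : clo I (cy c p) -> clo I (cy c' p).
Proof.
have up d : clo I (cy d p) <-> clo I (cy (d + 1) p).
  split=> [|/clo_sh]; last exact/clo_iso/cyc_deshift.
  by move=> Ic; apply/clo_unsh/(clo_iso _ Ic)/isomorphic_sym/cyc_deshift.
have all (k : nat) d : clo I (cy d p) <-> clo I (cy (d + k%:Z) p).
  elim: k d => [|k IHk] d; first by rewrite addr0.
  by rewrite up IHk (_ : d + 1 + k%:Z = d + k.+1%:Z) //; lia.
case: (leP c c') => cc'.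
  by rewrite (all `|c' - c|%N) (_ : c + _ = c') //; lia.
by rewrite [X in _ -> X](all `|c - c'|%N) (_ : c' + _ = c) //; lia.
Qed.

Lemma clo_cyc_dual I c p : (p <= n)%N -> clo I (cy c (n - p)) -> clo I (cy c p).
Proof.
move=> pn Ip; apply: clo_iso (isomorphic_sym (cyc_shift Ach c pn)) _.
exact: clo_sh.
Qed.

(** By [classify] only the M_p with p <= n matter, and those with p > m are shifts of M_(n-p), where
    n - p <= m. *)
Lemma clo_cyc_all I : (forall p, (p <= m)%N -> clo I (cy 0 p)) ->
  forall X, clo I X.
Proof.
move=> Im X; have [c [L [Ln _ XL]]] := classify Ach X.
apply: clo_min XL => _ [p pL ->]; have pn := Ln p pL.
apply: (@clo_cyc_degree I 0); have [pm|mp] := leqP p m; first exact: Im.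
by apply: clo_cyc_dual pn _; apply: Im; lia.
Qed.

Lemma gen_step I q r k t : (r <= q)%N -> (q + k <= n)%N ->
  gen I t (cy 0 (r + k)) -> clo I (cy 0 q) ->
  gen I t.+1 (cy 0 (q + k)) /\ gen I t.+1 (cy 0 r).
Proof.
move=> rq qkn G1 G2; have G3 := cyc_star rq qkn G1 G2.
have {}G3 := @clo_in (Dsg A) (star (gen I t) (clo I)) _ G3.
by split; [exact: (@clo_sum1 (Dsg A) (Dsg_coprods A)) G3
          | exact: (@clo_sum2 (Dsg A) (Dsg_coprods A)) G3].
Qed.

(** M_s is always the quotient term of the sequence. The first step reaches all lengths up to 2s,
    each later one adds s. *)
Lemma gen_cyc I s t : (0 < t)%N -> (s <= m)%N -> clo I (cy 0 s) ->
  forall j, (j <= t.+1 * s)%N -> (j <= m)%N -> gen I t (cy 0 j).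
Proof.
case: t => // t _ sm Is.
have step t' j k : (j <= s)%N -> (s + k <= n)%N -> gen I t' (cy 0 (j + k)) ->
    gen I t'.+1 (cy 0 (s + k)) /\ gen I t'.+1 (cy 0 j).
  by move=> js skn G; apply: gen_step.
elim: t => [|t IHt] j jts jm; have [js|sj] := leqP j s.
(* Short lengths are the smaller summand of M_s -> M_(2s-j) (+) M_j -> M_s. *)
- have skn : (s + (s - j) <= n)%N by lia.
  by have [|_ Gj] := step 0%N j (s - j)%N js skn; first rewrite subnKC.
(* The same sequence with M_j now the larger summand: r = 2s - j and k = j - s, so that r + k =
   s. *)
- have js : (s - (j - s) <= s)%N by lia.
  have skn : (s + (j - s) <= n)%N by lia.
  have [|Gj _] := step 0%N _ _ js skn; first by rewrite subnK //; lia.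
  by rewrite subnKC in Gj => //; apply: ltnW.
- have skn : (s + (s - j) <= n)%N by lia.
  have [|_ Gj //] := step t.+1 j (s - j)%N js skn; rewrite subnKC //.
  by apply: IHt => //; rewrite mulSn leq_addr.
(* With r = 0 the sequence is the extension M_(j-s) -> M_j -> M_s. *)
have skn : (s + (j - s) <= n)%N by lia.
have [|Gj _] := step t.+1 0%N _ (leq0n _) skn.
  by rewrite add0n; apply: IHt; lia.
by rewrite subnKC in Gj => //; apply: ltnW.
Qed.

Lemma generates_pos G s t : (0 < t)%N -> (s <= m)%N ->
  clo (fun Y => Y = G) (cy 0 s) -> (m <= t.+1 * s)%N -> generates G t.
Proof.
move=> t0 sm Gs mts X; apply: gen_clo; apply: clo_cyc_all => p pm.
apply: clo_in; apply: (gen_cyc t0 sm Gs _ pm).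
exact: leq_trans pm mts.
Qed.

Lemma generates_kill G s t : kill s G -> generates G t -> (m <= t.+1 * s)%N.
Proof.
move=> KG Gt; apply: kill_half.
have H := @kills_gen _ _ (Dsg_coprods A) (@tate_Dsg_exact _ _ _ _ Ach half_le)
  (@tate_kills_sh _ _ _ _ Ach half_le) (@tate_kills_zero _ _ _ _ Ach half_le)
  (@tate_kills_sum _ _ _ _ Ach half_le) s (fun Y => Y = G).
by apply: H (Gt _) => _ ->.
Qed.

Lemma kill_clo s I X : (forall Y, I Y -> kill s Y) -> clo I X -> kill s X.
Proof.
move=> IK; apply: (@kills_clo _ _ (Dsg_coprods A)
  (@tate_kills_sh _ _ _ _ Ach half_le) (@tate_kills_zero _ _ _ _ Ach half_le)
  (@tate_kills_sum _ _ _ _ Ach half_le)) => //.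
Qed.

Lemma clo_cyc0 I : clo I (cy 0 0).
Proof.
apply: clo_iso (clo_zero (Dsg_coprods A) _).
exists (to_Dsg (null_map (zero_cpx A) (cyc Ach 0 0))).
apply: bij_iso => i x; first by rewrite [x]thinmx0.
by exists 0; apply: val_inj; rewrite -[RHS]scale1r -[1](expr0 u) cyc_mem.
Qed.

Lemma generator_length G : exists s, [/\ (s <= m)%N, kill s G &
  clo (fun Y => Y = G) (cy 0 s)].
Proof.
have [c [L [Ln GL LG]]] := classify Ach G.
pose s := \max_(p <- L) minn p (n - p).
have KG : kill s G.
  apply: kill_clo LG => _ [p pL ->]; apply: kill_cyc_min; first exact: Ln.
  by rewrite /s; apply: (@leq_bigmax_seq _ L xpredT (fun p => minn p (n - p))).
(* An empty list gives s = 0, realized by the zero object M_0; otherwise the maximum is attained. *)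
have sP : s = 0%N \/ exists2 p, p \in L & s = minn p (n - p).
  rewrite /s; elim: (L) => [|p L' IH]; first by rewrite big_nil; left.
  rewrite big_cons /maxn; case: ifP => _.
    by case: IH => [->|[q qL ->]]; [left | right; exists q; rewrite ?inE ?qL
      ?orbT].
  by right; exists p; rewrite ?inE ?eqxx.
exists s; split=> //; case: sP => [->|[p pL ->]] //; try by lia.
  exact: clo_cyc0.
have pn := Ln p pL; have Gp := @clo_cyc_degree _ c 0 p (GL p pL).
rewrite /minn; case: ifP => _ //.
by apply: clo_cyc_dual; [lia | rewrite subKn].
Qed.

(** The inequalities say that t + 1 is the ceiling of m / s. *)
Lemma spectrum_chain t : Orlov_spectrum (Dsg A) t <->
  exists2 s, (1 <= s)%N & (t * s < m <= t.+1 * s)%N.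
Proof.
split=> [[G [Gt Gmin]] | [s s1 /andP[tsm mts]]].
  have [s [sm KG Gs]] := generator_length G.
  have mts := generates_kill KG Gt.
  have m0 : (0 < m)%N by lia.
  have s0 : (0 < s)%N by move: mts; case: (s) => //; rewrite muln0; lia.
  have [t0|t0] := posnP t; first by exists m; rewrite // t0; lia.
  (* For t >= 2, [generates_pos] still applies to t - 1, so minimality of t gives t * s < m. *)
  have [t1|t1] := eqVneq t 1%N; last first.
    exists s => //; rewrite mts andbT ltnNge; apply/negP => mts'.
    have /Gmin : generates G t.-1.
      by apply: generates_pos sm Gs _; [lia | rewrite prednK].
    by lia.
  (* If m = 1, the lengths up to m are 0 and s, so [G] generates in zero steps, against t = 1. *)
  have m2 : (2 <= m)%N.
    rewrite ltnNge; apply/negP => m1; suff /Gmin : generates G 0 by lia.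
    move=> X; apply: clo_cyc_all => p pm.
    have [->|->] : p = 0%N \/ p = s by lia.
      exact: clo_cyc0.
    exact: Gs.
  by exists m.-1; rewrite ?t1; lia.
(* All lengths up to [s'] are included, so that time 0 is attained when s >= m. *)
pose s' := minn s m; pose X (a : 'I_s'.+1) := cy 0 a.
have [G [inj [injP KG]]] := @coproduct_exists _ (Dsg_coprods A) (kill s') _ X
  (@tate_kills_zero _ _ _ _ Ach half_le s') (@tate_kills_sum _ _ _ _ Ach
    half_le s').
have Gs p : (p <= s')%N -> clo (fun Y => Y = G) (cy 0 p).
  by move=> ps; apply: (clo_summand injP (clo_in _) (Ordinal (ps :
    p < s'.+1)%N)).
exists G; split=> [|t' Gt'].
  have [t0|t0] := posnP t.
    by rewrite t0 => Y; apply: clo_cyc_all => p pm; apply: Gs; rewrite /s'; lia.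
  apply: (@generates_pos _ s) => //; first by nia.
  by apply: Gs; rewrite /s'; nia.
have mts' := @generates_kill G s' t' _ Gt'.
have {}mts' : (m <= t'.+1 * s')%N.
  by apply: mts'; apply/KG => a; apply: kill_cyc; rewrite -ltnS.
have ss : (t'.+1 * s' <= t'.+1 * s)%N by rewrite leq_mul2l geq_minl orbT.
by rewrite -ltnS -(ltn_pmul2r s1); apply: leq_trans tsm (leq_trans mts' ss).
Qed.

End Spectrum.

(** * Truncated polynomial rings *)

(** A nonzero residue is represented by X^j q with q(0) nonzero; then q is coprime to X^n and a
    Bezout relation inverts it. *)
Lemma qpoly_Xn_chain (k : fieldType) (n : nat) : (0 < n)%N ->
  chain_ring (in_qpoly ('X^n : {poly k}) 'X) n.
Proof.
(* Quotients are taken modulo [mk_monic], which leaves X^n unchanged for n > 0. *)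
move=> n0; have hE : mk_monic ('X^n : {poly k}) = 'X^n.
  by rewrite mk_monic_Xn prednK.
have uE i : in_qpoly ('X^n : {poly k}) 'X ^+ i = in_qpoly 'X^n 'X^i.
  by rewrite rmorphXn.
have in0 (p : {poly k}) : in_qpoly 'X^n ('X^n * p) = 0.
  apply: val_inj; rewrite /= hE mulrC.
  by rewrite Pdiv.RingMonic.rmodp_mull ?monicXn.
have un0 : in_qpoly ('X^n : {poly k}) 'X ^+ n = 0 by rewrite uE -(in0 1) mulr1.
split=> [//|i lt_in|a].
- rewrite uE; apply/eqP => /(congr1 val) /=.
  rewrite Pdiv.Ring.rmodp_small ?hE ?size_polyXn // => /eqP.
  by apply/negP/monic_neq0/monicXn.
have [a0|a0] := eqVneq (a : {poly k}) 0.
  exists n, 1, 1; rewrite !mulr1 un0; split=> //.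
  exact: val_inj.
have [j [q q0 aE]] := multiplicity_XsubC (a : {poly k}) 0.
rewrite subr0 in aE; move: q0; rewrite a0 /= => q0.
have /Bezout_eq1_coprimepP [[v w] /= vw] : coprimep 'X^n q.
  by apply: coprimep_expl; rewrite coprimep_sym coprimepX.
exists j, (in_qpoly 'X^n q), (in_qpoly 'X^n w); split.
  by rewrite -rmorphM -[LHS]add0r -(in0 v) -rmorphD mulrC (mulrC q) vw rmorph1.
rewrite uE -rmorphM mulrC -aE; apply: val_inj => /=.
by rewrite Pdiv.Ring.rmodp_small // size_mk_monic.
Qed.

(** The ceiling of x is t + 1 exactly when t < x <= t + 1; multiplying by s returns to natural
    numbers. *)
Lemma ceil_half_div (n s t : nat) : (0 < s)%N ->
  t%:Z = Num.ceil ((Num.floor (n%:R / 2 : rat))%:~R / s%:R : rat) - 1 <->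
  (t * s < n./2 <= t.+1 * s)%N.
Proof.
move=> s0; have -> : Num.floor (n%:R / 2 : rat) = (n./2)%:Z.
  apply: floor_def; rewrite ler_pdivlMr // ltr_pdivrMr //.
  rewrite (_ : n./2%:Z + 1 = n./2.+1%:Z); last by lia.
  by rewrite -!pmulrn -!natrM ler_nat ltr_nat; lia.
have s0' : (0 : rat) < s%:R by rewrite ltr0n.
rewrite (rwP eqP) eq_sym subr_eq ceil_eq addrK ltr_pdivlMr // ler_pdivrMr //.
rewrite (_ : t%:Z + 1 = t.+1%:Z); last by lia.
by rewrite -!pmulrn -!natrM ler_nat ltr_nat.
Qed.

Unset Implicit Arguments.

Theorem theorem1p9 (k : closedFieldType) (char0 : [pchar k] =i pred0)
    (n : nat) (n_ge2 : (2 <= n)%N) (t : nat) :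
  Orlov_spectrum (Dsg {poly %/ ('X^n : {poly k})}) t <->
  exists2 s : nat, (1 <= s)%N &
    t%:Z = Num.ceil ((Num.floor (n%:R / 2 : rat))%:~R / s%:R : rat) - 1.
Proof.
rewrite (spectrum_chain (qpoly_Xn_chain k (ltnW n_ge2)) n_ge2).
by split=> -[s s1 /(ceil_half_div n t s1)]; exists s.
Qed.
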